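(* Let $\mathscr C$ be a $1$-category and consider the $2$-category $\mathsf{Bicat}(\mathscr C^{\mathrm{op}},\mathbf{Cat})$. Then a tuple $(F,T,p,\mathrm{add},0,\ell,c)$ in $\mathsf{Bicat}(\mathscr C^{\mathrm{op}},\mathbf{Cat})$ is a tangent object (in the sense of Lanfranchi) if and only if $F:\mathscr C^{\mathrm{op}}\to\mathbf{Cat}$ is a tangent indexing functor.
   Context: $\mathsf{Bicat}(\mathscr C^{\mathrm{op}},\mathbf{Cat})$ is the $2$-category of (normalized) pseudofunctors, pseudonatural transformations and modifications. In the tuple, $F:\mathscr C^{\mathrm{op}}\to\mathbf{Cat}$ is a pseudofunctor, $T:F\Rightarrow F$ a pseudonatural transformation, and $p,\mathrm{add},0,\ell,c$ are modifications of the types listed below for tangent objects. Tangent categories. A tangent structure $\mathbb T=(T,p,0,+,\ell,c)$ on a category $\mathscr D$ consists of a functor $T:\mathscr D\to\mathscr D$ and natural transformations $p:T\Rightarrow\mathrm{id}$, $0:\mathrm{id}\Rightarrow T$, $+:T_2\Rightarrow T$, $\ell:T\Rightarrow T^2$, $c:T^2\Rightarrow T^2$ such that: (1) for every object $A$ and $n\in\mathbb N$ the $n$-fold pullback power $T_nA$ of $p_A:TA\to A$ exists and is preserved by all $T^m$; (2) $(p_A,+_A,0_A)$ is a commutative monoid in $\mathscr D_{/A}$; (3) $T(p_A)\ell_A=0_Ap_A$, $\ell_A\circ{+_A}=T(+_A)\circ\langle\ell_A\pi_1,\ell_A\pi_2\rangle$, $\ell_A0_A=T(0_A)0_A$; (4)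 $p_{TA}c_A=T(p_A)$, $c_A\circ T(+_A)={+_{TA}}\circ\langle c_AT(\pi_1),c_AT(\pi_2)\rangle$, $c_AT(0_A)=0_{TA}$; (5) $c_Ac_A=\mathrm{id}$, $c_A\ell_A=\ell_A$, $T(\ell_A)\ell_A=\ell_{TA}\ell_A$, $c_{TA}T(c_A)c_{TA}=T(c_A)c_{TA}T(c_A)$, $c_{TA}T(c_A)\ell_{TA}=T(\ell_A)c_A$; (6) $T(+_A)\circ\langle\ell_A\pi_1,0_{TA}\pi_2\rangle:T_2A\to T^2A$ is an equalizer of $T(p_A)$ and $0_A\,p_A\,p_{TA}:T^2A\rightrightarrows TA$. Tangent objects (Lanfranchi). A tangent object in a $2$-category $\mathcal K$ is an object $X$ with a $1$-cell $T:X\to X$ and $2$-cells $p:T\Rightarrow\mathrm{id}_X$, $0:\mathrm{id}_X\Rightarrow T$, $\mathrm{add}:T_2\Rightarrow T$, $\ell:T\Rightarrow T^2$, $c:T^2\Rightarrow T^2$ satisfying the axioms of a tangent category read in the hom-category $\mathcal K(X,X)$: the pullback powers $T_n$ of $p$ exist in $\mathcal K(X,X)$, are preserved by post-composition with all $T^m$, and are pointwise (preserved by the precomposition functors $\mathcal K(f,X)$ for all $1$-cells $f:X'\to X$); $(T,\mathrm{add},0)$ is a commutative monoid over $\mathrm{id}_X$; the equations (3)–(5) above hold with $T(-)$ and $(-)_T$ read as whiskerings; and the square with top edge $(T\ast\mathrm{add})\circ\langle\ell\pi_1,(0\ast T)\pi_2\rangle:T_2\Rightarrow T^2$, left edge $p\circ\pi_1:T_2\Rightarrow\mathrm{id}_X$,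 right edge $T\ast p:T^2\Rightarrow T$ and bottom edge $0:\mathrm{id}_X\Rightarrow T$ is a pointwise pullback. (Equivalently: a strong monoidal functor $\mathsf{Weil}_1\to\mathcal K(X,X)$ from the category of Weil algebras preserving the fundamental tangent pullbacks pointwise.) Morphisms. A morphism of tangent categories $(\mathscr D,\mathbb T)\to(\mathscr E,\mathbb S)$, with $\mathbb S=(S,q,0',\oplus,\ell',c')$, is a pair $(H,\alpha)$ with $H:\mathscr D\to\mathscr E$ a functor and $\alpha:H\circ T\Rightarrow S\circ H$ natural with $(q H)\alpha=Hp$, $\alpha (H0)=0'H$, $\alpha (H{+})=(\oplus H)\alpha_2$ ($\alpha_2:HT_2\Rightarrow S_2H$ induced by $\alpha$), $(\ell' H)\alpha=(S\alpha)(\alpha T)(H\ell)$, $(c'H)(S\alpha)(\alpha T)=(S\alpha)(\alpha T)(Hc)$. It is strong if $\alpha$ is invertible and $H$ preserves the pullbacks and equalizers of the tangent structure. Tangent indexing functors. A pseudofunctor $F:\mathscr C^{\mathrm{op}}\to\mathbf{Cat}$ is a tangent indexing functor if (i) each $F(X)$ is equipped with a tangent structure ${}_X\mathbb T$ with tangent functor ${}_XT$; (ii) for each $f:X\to Y$ there is a natural isomorphism ${}_fT:F(f)\circ{}_YT\Rightarrow{}_XT\circ F(f)$ such that $(F(f),{}_fT):(F(Y),{}_Y\mathbb T)\to(F(X),{}_X\mathbb T)$ is a strong tangent morphism; (iii) the functors ${}_XT$ together with the isomorphisms ${}_fT^{-1}$ form a pseudonatural transformation $F\Rightarrow F$. 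*)

(* Defs.v *)
From Stdlib Require Import FunctionalExtensionality ProofIrrelevance.
From Stdlib Require Fin.

Set Implicit Arguments.
Unset Strict Implicit.
Set Primitive Projections.

Declare Scope cat_scope.
Delimit Scope cat_scope with cat.
Open Scope cat_scope.

(** * Categories, functors, natural transformations *)

Record Category := {
  Ob :> Type;
  Hom : Ob -> Ob -> Type;
  idc : forall A, Hom A A;
  comp : forall A B D, Hom B D -> Hom A B -> Hom A D;
  comp_id_l : forall A B (f : Hom A B), comp (idc B) f = f;
  comp_id_r : forall A B (f : Hom A B), comp f (idc A) = f;
  comp_assoc : forall A B D E (h : Hom D E) (g : Hom B D) (f : Hom A B),
    comp h (comp g f) = comp (comp h g) f
}.

Arguments Hom {_} _ _.
Arguments idc {_} _.
Arguments comp {_ _ _ _} _ _.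

Notation "g ∘ f" := (comp g f) (at level 40, left associativity) : cat_scope.

Definition eq_hom (D : Category) (A B : D) (e : A = B) : Hom A B :=
  match e with eq_refl => idc A end.

Record Functor (D E : Category) := {
  fob :> D -> E;
  fmap : forall A B, Hom A B -> Hom (fob A) (fob B);
  fmap_id : forall A, fmap (idc A) = idc (fob A);
  fmap_comp : forall A B B' (g : Hom B B') (f : Hom A B),
    fmap (g ∘ f) = fmap g ∘ fmap f
}.

Arguments fmap {_ _} _ {_ _} _.

Program Definition Fid (D : Category) : Functor D D :=
  {| fob := fun A => A; fmap := fun _ _ f => f |}.

Program Definition Fcomp (D E E' : Category) (G : Functor E E') (F : Functor D E) :
    Functor D E' :=
  {| fob := fun A => G (F A); fmap := fun _ _ f => fmap G (fmap F f) |}.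
Next Obligation. now rewrite !fmap_id. Qed.
Next Obligation. now rewrite !fmap_comp. Qed.

Notation "G ∘F F" := (Fcomp G F) (at level 40, left associativity) : cat_scope.

Fixpoint Fiter (D : Category) (T : Functor D D) (m : nat) : Functor D D :=
  match m with O => Fid D | S m' => T ∘F Fiter T m' end.

Record NatTrans (D E : Category) (F G : Functor D E) := {
  nt :> forall A, Hom (F A) (G A);
  nt_nat : forall A B (f : Hom A B), nt B ∘ fmap F f = fmap G f ∘ nt A
}.

Record NatIso (D E : Category) (F G : Functor D E) := {
  niso :> NatTrans F G;
  niso_inv : NatTrans G F;
  niso_inv_l : forall A, niso_inv A ∘ niso A = idc (F A);
  niso_inv_r : forall A, niso A ∘ niso_inv A = idc (G A)
}.

Definition niso_sym (D E : Category) (F G : Functor D E) (a : NatIso F G) : NatIso G F :=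
  {| niso := niso_inv a; niso_inv := niso a;
     niso_inv_l := niso_inv_r a; niso_inv_r := niso_inv_l a |}.

(** * Limits *)

(** The base map [b] belongs to the cone, so that the [0]-fold power of
    [p : P -> Q] is [Q]. *)
Definition IsPullbackPower (D : Category) (P Q : D) (p : Hom P Q) (n : nat)
    (L : D) (b : Hom L Q) (pr : Fin.t n -> Hom L P) : Prop :=
  (forall i, p ∘ pr i = b) /\
  forall (Z : D) (z : Hom Z Q) (zs : Fin.t n -> Hom Z P),
    (forall i, p ∘ zs i = z) ->
    exists! u : Hom Z L, b ∘ u = z /\ forall i, pr i ∘ u = zs i.

Definition IsPullback (D : Category) (A B Q : D) (f : Hom A Q) (g : Hom B Q)
    (L : D) (l1 : Hom L A) (l2 : Hom L B) : Prop :=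
  f ∘ l1 = g ∘ l2 /\
  forall (Z : D) (z1 : Hom Z A) (z2 : Hom Z B), f ∘ z1 = g ∘ z2 ->
    exists! u : Hom Z L, l1 ∘ u = z1 /\ l2 ∘ u = z2.

Definition IsEqualizer (D : Category) (A B : D) (f g : Hom A B)
    (L : D) (l : Hom L A) : Prop :=
  f ∘ l = g ∘ l /\
  forall (Z : D) (z : Hom Z A), f ∘ z = g ∘ z -> exists! u : Hom Z L, l ∘ u = z.

(** A commutative monoid [(p, add, zero)] in the slice over [A], whose binary
    product [E2] is a pullback of [p] along itself.  The monoid laws are
    equations between generalized elements: a map [u] into [E2] stands for the
    pair of [pi1 ∘ u] and [pi2 ∘ u].  In [cm_assoc], the maps [xy], [yz], [xy_z]
    and [x_yz] are the pairs (x, y), (y, z), (x + y, z) and (x, y + z). *)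
#[projections(primitive=no)]
Record IsCommMonoidOver (D : Category) (A E E2 : D) (p : Hom E A)
    (pi1 pi2 : Hom E2 E) (zero : Hom A E) (add : Hom E2 E) : Prop := {
  cm_product : IsPullback p p pi1 pi2;
  cm_zero_over : p ∘ zero = idc A;
  cm_add_over : p ∘ add = p ∘ pi1;
  cm_unit : forall (Z : D) (u : Hom Z E2),
    pi1 ∘ u = zero ∘ p ∘ pi2 ∘ u -> add ∘ u = pi2 ∘ u;
  cm_comm : forall (Z : D) (u v : Hom Z E2),
    pi1 ∘ v = pi2 ∘ u -> pi2 ∘ v = pi1 ∘ u -> add ∘ v = add ∘ u;
  cm_assoc : forall (Z : D) (xy yz xy_z x_yz : Hom Z E2),
    pi2 ∘ xy = pi1 ∘ yz ->
    pi1 ∘ xy_z = add ∘ xy -> pi2 ∘ xy_z = pi2 ∘ yz ->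
    pi1 ∘ x_yz = pi1 ∘ xy -> pi2 ∘ x_yz = add ∘ yz ->
    add ∘ xy_z = add ∘ x_yz
}.

(** * Tangent categories *)

(** The pullback [T2] which is the source of the addition is a chosen one, and
    is part of the data together with its projections. *)
Record TangentData (D : Category) := {
  tT : Functor D D;
  tT2 : Functor D D;
  tpi1 : NatTrans tT2 tT;
  tpi2 : NatTrans tT2 tT;
  tp : NatTrans tT (Fid D);
  tzero : NatTrans (Fid D) tT;
  tadd : NatTrans tT2 tT;
  tlift : NatTrans tT (tT ∘F tT);
  tflip : NatTrans (tT ∘F tT) (tT ∘F tT)
}.

(** Maps induced by a universal property, such as the pairing of [ℓ pi1] and
    [ℓ pi2], are introduced by an existential quantifier together with the
    equations which determine them. *)
#[projections(primitive=no)]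
Record IsTangentStructure (D : Category) (t : TangentData D) : Prop := {
  ts_powers : forall (A : D) (n : nat),
    exists (L : D) (b : Hom L A) (pr : Fin.t n -> Hom L (tT t A)),
      IsPullbackPower (tp t A) b pr /\
      forall m, IsPullbackPower (fmap (Fiter (tT t) m) (tp t A))
        (fmap (Fiter (tT t) m) b) (fun i => fmap (Fiter (tT t) m) (pr i));
  ts_monoid : forall A : D,
    IsCommMonoidOver (tp t A) (tpi1 t A) (tpi2 t A) (tzero t A) (tadd t A);
  ts_lift_p : forall A : D,
    fmap (tT t) (tp t A) ∘ tlift t A = tzero t A ∘ tp t A;
  ts_lift_add : forall A : D,
    exists u : Hom (tT2 t A) (tT t (tT2 t A)),
      fmap (tT t) (tpi1 t A) ∘ u = tlift t A ∘ tpi1 t A /\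
      fmap (tT t) (tpi2 t A) ∘ u = tlift t A ∘ tpi2 t A /\
      tlift t A ∘ tadd t A = fmap (tT t) (tadd t A) ∘ u;
  ts_lift_zero : forall A : D,
    tlift t A ∘ tzero t A = fmap (tT t) (tzero t A) ∘ tzero t A;
  ts_flip_p : forall A : D,
    tp t (tT t A) ∘ tflip t A = fmap (tT t) (tp t A);
  ts_flip_add : forall A : D,
    exists u : Hom (tT t (tT2 t A)) (tT2 t (tT t A)),
      tpi1 t (tT t A) ∘ u = tflip t A ∘ fmap (tT t) (tpi1 t A) /\
      tpi2 t (tT t A) ∘ u = tflip t A ∘ fmap (tT t) (tpi2 t A) /\
      tflip t A ∘ fmap (tT t) (tadd t A) = tadd t (tT t A) ∘ u;
  ts_flip_zero : forall A : D,
    tflip t A ∘ fmap (tT t) (tzero t A) = tzero t (tT t A);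
  ts_flip_flip : forall A : D,
    tflip t A ∘ tflip t A = idc (tT t (tT t A));
  ts_flip_lift : forall A : D, tflip t A ∘ tlift t A = tlift t A;
  ts_lift_lift : forall A : D,
    fmap (tT t) (tlift t A) ∘ tlift t A = tlift t (tT t A) ∘ tlift t A;
  ts_hexagon : forall A : D,
    tflip t (tT t A) ∘ fmap (tT t) (tflip t A) ∘ tflip t (tT t A)
    = fmap (tT t) (tflip t A) ∘ tflip t (tT t A) ∘ fmap (tT t) (tflip t A);
  ts_flip_flip_lift : forall A : D,
    tflip t (tT t A) ∘ fmap (tT t) (tflip t A) ∘ tlift t (tT t A)
    = fmap (tT t) (tlift t A) ∘ tflip t A;
  ts_universal : forall A : D,
    exists u : Hom (tT2 t A) (tT t (tT2 t A)),
      fmap (tT t) (tpi1 t A) ∘ u = tlift t A ∘ tpi1 t A /\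
      fmap (tT t) (tpi2 t A) ∘ u = tzero t (tT t A) ∘ tpi2 t A /\
      IsEqualizer (fmap (tT t) (tp t A)) (tzero t A ∘ tp t A ∘ tp t (tT t A))
        (fmap (tT t) (tadd t A) ∘ u)
}.

#[projections(primitive=no)]
Record IsTangentMorphism (D E : Category) (t : TangentData D) (s : TangentData E)
    (H : Functor D E) (a : NatTrans (H ∘F tT t) (tT s ∘F H)) : Prop := {
  tm_p : forall A : D, tp s (H A) ∘ a A = fmap H (tp t A);
  tm_zero : forall A : D, a A ∘ fmap H (tzero t A) = tzero s (H A);
  tm_add : forall A : D,
    exists a2 : Hom (H (tT2 t A)) (tT2 s (H A)),
      tpi1 s (H A) ∘ a2 = a A ∘ fmap H (tpi1 t A) /\
      tpi2 s (H A) ∘ a2 = a A ∘ fmap H (tpi2 t A) /\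
      a A ∘ fmap H (tadd t A) = tadd s (H A) ∘ a2;
  tm_lift : forall A : D,
    tlift s (H A) ∘ a A = fmap (tT s) (a A) ∘ a (tT t A) ∘ fmap H (tlift t A);
  tm_flip : forall A : D,
    tflip s (H A) ∘ (fmap (tT s) (a A) ∘ a (tT t A))
    = fmap (tT s) (a A) ∘ a (tT t A) ∘ fmap H (tflip t A)
}.

#[projections(primitive=no)]
Record IsStrongTangentMorphism (D E : Category) (t : TangentData D) (s : TangentData E)
    (H : Functor D E) (a : NatIso (H ∘F tT t) (tT s ∘F H)) : Prop := {
  stm_morphism : IsTangentMorphism a;
  stm_powers : forall (A : D) (n : nat) (L : D) (b : Hom L A)
      (pr : Fin.t n -> Hom L (tT t A)),
    IsPullbackPower (tp t A) b pr ->
    IsPullbackPower (fmap H (tp t A)) (fmap H b) (fun i => fmap H (pr i));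
  stm_equalizers : forall (A : D) (L : D) (l : Hom L (tT t (tT t A))),
    IsEqualizer (fmap (tT t) (tp t A)) (tzero t A ∘ tp t A ∘ tp t (tT t A)) l ->
    IsEqualizer (fmap H (fmap (tT t) (tp t A)))
      (fmap H (tzero t A ∘ tp t A ∘ tp t (tT t A))) (fmap H l)
}.

(** * Tangent objects in a 2-category *)

(** Strict 2-categories.  [wl g a] and [wr a f] are the whiskerings [g ∗ a] and
    [a ∗ f].  As 1-cells are associative and unital up to Leibniz equality, the
    strictness laws on 2-cells are stated modulo [eq_hom]. *)
Record TwoCategory := {
  cell0 :> Type;
  cell1 : cell0 -> cell0 -> Category;
  id1 : forall X, cell1 X X;
  comp1 : forall X Y Z, cell1 Y Z -> cell1 X Y -> cell1 X Z;
  wl : forall X Y Z (g : cell1 Y Z) (f f' : cell1 X Y),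
    Hom f f' -> Hom (comp1 g f) (comp1 g f');
  wr : forall X Y Z (g g' : cell1 Y Z),
    Hom g g' -> forall f : cell1 X Y, Hom (comp1 g f) (comp1 g' f);
  wl_id : forall X Y Z (g : cell1 Y Z) (f : cell1 X Y),
    wl g (idc f) = idc (comp1 g f);
  wl_comp : forall X Y Z (g : cell1 Y Z) (f f' f'' : cell1 X Y)
      (b : Hom f' f'') (a : Hom f f'),
    wl g (b ∘ a) = wl g b ∘ wl g a;
  wr_id : forall X Y Z (g : cell1 Y Z) (f : cell1 X Y),
    wr (idc g) f = idc (comp1 g f);
  wr_comp : forall X Y Z (g g' g'' : cell1 Y Z) (b : Hom g' g'') (a : Hom g g')
      (f : cell1 X Y),
    wr (b ∘ a) f = wr b f ∘ wr a f;
  interchange : forall X Y Z (g g' : cell1 Y Z) (f f' : cell1 X Y)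
      (b : Hom g g') (a : Hom f f'),
    wl g' a ∘ wr b f = wr b f' ∘ wl g a;
  comp1_id_l : forall X Y (f : cell1 X Y), comp1 (id1 Y) f = f;
  comp1_id_r : forall X Y (f : cell1 X Y), comp1 f (id1 X) = f;
  comp1_assoc : forall W X Y Z (h : cell1 Y Z) (g : cell1 X Y) (f : cell1 W X),
    comp1 h (comp1 g f) = comp1 (comp1 h g) f;
  wl_id1 : forall X Y (f f' : cell1 X Y) (a : Hom f f'),
    eq_hom (comp1_id_l f') ∘ wl (id1 Y) a = a ∘ eq_hom (comp1_id_l f);
  wr_id1 : forall X Y (f f' : cell1 X Y) (a : Hom f f'),
    eq_hom (comp1_id_r f') ∘ wr a (id1 X) = a ∘ eq_hom (comp1_id_r f);
  wl_comp1 : forall W X Y Z (h : cell1 Y Z) (g : cell1 X Y) (f f' : cell1 W X)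
      (a : Hom f f'),
    eq_hom (comp1_assoc h g f') ∘ wl h (wl g a)
    = wl (comp1 h g) a ∘ eq_hom (comp1_assoc h g f);
  wl_wr : forall W X Y Z (h : cell1 Y Z) (g g' : cell1 X Y) (a : Hom g g')
      (f : cell1 W X),
    eq_hom (comp1_assoc h g' f) ∘ wl h (wr a f)
    = wr (wl h a) f ∘ eq_hom (comp1_assoc h g f);
  wr_comp1 : forall W X Y Z (h h' : cell1 Y Z) (a : Hom h h') (g : cell1 X Y)
      (f : cell1 W X),
    eq_hom (comp1_assoc h' g f) ∘ wr a (comp1 g f)
    = wr (wr a g) f ∘ eq_hom (comp1_assoc h g f)
}.

Arguments cell1 {_} _ _.
Arguments id1 {_} _.
Arguments comp1 {_ _ _ _} _ _.
Arguments wl {_ _ _ _} _ {_ _} _.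
Arguments wr {_ _ _ _ _ _} _ _.

Section Tangent_objects.
Variable K : TwoCategory.

Definition postcomp (X Y Z : K) (g : cell1 Y Z) : Functor (cell1 X Y) (cell1 X Z) :=
  {| fob := fun f => comp1 g f; fmap := fun _ _ a => wl g a;
     fmap_id := fun f => wl_id g f;
     fmap_comp := fun _ _ _ b a => wl_comp g b a |}.

Definition precomp (X Y Z : K) (f : cell1 X Y) : Functor (cell1 Y Z) (cell1 X Z) :=
  {| fob := fun g => comp1 g f; fmap := fun _ _ a => wr a f;
     fmap_id := fun g => wr_id g f;
     fmap_comp := fun _ _ _ b a => wr_comp b a f |}.

Definition IsPointwisePullbackPower (X Y : K) (P Q : cell1 X Y) (p : Hom P Q) (n : nat)
    (L : cell1 X Y) (b : Hom L Q) (pr : Fin.t n -> Hom L P) : Prop :=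
  IsPullbackPower p b pr /\
  forall (X' : K) (h : cell1 X' X),
    IsPullbackPower (fmap (precomp Y h) p) (fmap (precomp Y h) b)
      (fun i => fmap (precomp Y h) (pr i)).

Definition IsPointwisePullback (X Y : K) (A B Q : cell1 X Y) (f : Hom A Q) (g : Hom B Q)
    (L : cell1 X Y) (l1 : Hom L A) (l2 : Hom L B) : Prop :=
  IsPullback f g l1 l2 /\
  forall (X' : K) (h : cell1 X' X),
    IsPullback (fmap (precomp Y h) f) (fmap (precomp Y h) g)
      (fmap (precomp Y h) l1) (fmap (precomp Y h) l2).

Record TangentTuple (X : K) := {
  oT : cell1 X X;
  oT2 : cell1 X X;
  opi1 : Hom oT2 oT;
  opi2 : Hom oT2 oT;
  op : Hom oT (id1 X);
  ozero : Hom (id1 X) oT;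
  oadd : Hom oT2 oT;
  olift : Hom oT (comp1 oT oT);
  oflip : Hom (comp1 oT oT) (comp1 oT oT)
}.

(** The whiskerings of the structure 2-cells, corrected by the strict unit and
    associativity laws so that [T T T] always stands for [T (T T)]. *)
Section Whiskerings.
Variables (X : K) (t : TangentTuple X).
Local Notation T := (oT t).

Definition T_p : Hom (comp1 T T) T := eq_hom (comp1_id_r T) ∘ wl T (op t).
Definition p_T : Hom (comp1 T T) T := eq_hom (comp1_id_l T) ∘ wr (op t) T.
Definition T_zero : Hom T (comp1 T T) :=
  wl T (ozero t) ∘ eq_hom (eq_sym (comp1_id_r T)).
Definition zero_T : Hom T (comp1 T T) :=
  wr (ozero t) T ∘ eq_hom (eq_sym (comp1_id_l T)).
Definition T_lift : Hom (comp1 T T) (comp1 T (comp1 T T)) := wl T (olift t).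
Definition lift_T : Hom (comp1 T T) (comp1 T (comp1 T T)) :=
  eq_hom (eq_sym (comp1_assoc T T T)) ∘ wr (olift t) T.
Definition T_flip : Hom (comp1 T (comp1 T T)) (comp1 T (comp1 T T)) := wl T (oflip t).
Definition flip_T : Hom (comp1 T (comp1 T T)) (comp1 T (comp1 T T)) :=
  eq_hom (eq_sym (comp1_assoc T T T)) ∘ wr (oflip t) T ∘ eq_hom (comp1_assoc T T T).
End Whiskerings.

(** The powers [T^m ∗ T_n] are required to be pointwise, i.e. each [T^m]
    preserves the pullbacks [T_n] as pointwise pullbacks. *)
#[projections(primitive=no)]
Record IsTangentObject (X : K) (t : TangentTuple X) : Prop := {
  to_powers : forall n : nat,
    exists (L : cell1 X X) (b : Hom L (id1 X)) (pr : Fin.t n -> Hom L (oT t)),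
      IsPointwisePullbackPower (op t) b pr /\
      forall m, IsPointwisePullbackPower (fmap (Fiter (postcomp X (oT t)) m) (op t))
        (fmap (Fiter (postcomp X (oT t)) m) b)
        (fun i => fmap (Fiter (postcomp X (oT t)) m) (pr i));
  to_monoid : IsCommMonoidOver (op t) (opi1 t) (opi2 t) (ozero t) (oadd t);
  to_lift_p : T_p t ∘ olift t = ozero t ∘ op t;
  to_lift_add : exists u : Hom (oT2 t) (comp1 (oT t) (oT2 t)),
    wl (oT t) (opi1 t) ∘ u = olift t ∘ opi1 t /\
    wl (oT t) (opi2 t) ∘ u = olift t ∘ opi2 t /\
    olift t ∘ oadd t = wl (oT t) (oadd t) ∘ u;
  to_lift_zero : olift t ∘ ozero t = T_zero t ∘ ozero t;
  to_flip_p : p_T t ∘ oflip t = T_p t;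
  to_flip_add : exists u : Hom (comp1 (oT t) (oT2 t)) (comp1 (oT2 t) (oT t)),
    wr (opi1 t) (oT t) ∘ u = oflip t ∘ wl (oT t) (opi1 t) /\
    wr (opi2 t) (oT t) ∘ u = oflip t ∘ wl (oT t) (opi2 t) /\
    oflip t ∘ wl (oT t) (oadd t) = wr (oadd t) (oT t) ∘ u;
  to_flip_zero : oflip t ∘ T_zero t = zero_T t;
  to_flip_flip : oflip t ∘ oflip t = idc (comp1 (oT t) (oT t));
  to_flip_lift : oflip t ∘ olift t = olift t;
  to_lift_lift : T_lift t ∘ olift t = lift_T t ∘ olift t;
  to_hexagon : flip_T t ∘ T_flip t ∘ flip_T t = T_flip t ∘ flip_T t ∘ T_flip t;
  to_flip_flip_lift : flip_T t ∘ T_flip t ∘ lift_T t = T_lift t ∘ oflip t;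
  to_universal : exists u : Hom (oT2 t) (comp1 (oT t) (oT2 t)),
    wl (oT t) (opi1 t) ∘ u = olift t ∘ opi1 t /\
    wl (oT t) (opi2 t) ∘ u = zero_T t ∘ opi2 t /\
    IsPointwisePullback (T_p t) (ozero t) (wl (oT t) (oadd t) ∘ u) (op t ∘ opi1 t)
}.

End Tangent_objects.

(** * Pseudofunctors [C^op -> Cat] *)

(** Normalized: [F (id X)] is equal to the identity functor, and the comparison
    cells at identities are identities.  A comparison cell between objects which
    are merely propositionally equal is required to be [eq_hom e] for every proof
    [e] of the equality; such a proof exists in each case, by [pf_id] and the
    laws of [C], and is unique by proof irrelevance. *)
Record Pseudofunctor (C : Category) := {
  pf_fib :> C -> Category;
  pf_map : forall X Y : C, Hom X Y -> Functor (pf_fib Y) (pf_fib X);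
  pf_comp : forall (X Y Z : C) (f : Hom X Y) (g : Hom Y Z),
    NatIso (pf_map f ∘F pf_map g) (pf_map (g ∘ f));
  pf_id : forall X : C, pf_map (idc X) = Fid (pf_fib X);
  pf_comp_id_l : forall (X Y : C) (f : Hom X Y) (A : pf_fib Y)
      (e : pf_map (idc X) (pf_map f A) = pf_map (f ∘ idc X) A),
    pf_comp (idc X) f A = eq_hom e;
  pf_comp_id_r : forall (X Y : C) (f : Hom X Y) (A : pf_fib Y)
      (e : pf_map f (pf_map (idc Y) A) = pf_map (idc Y ∘ f) A),
    pf_comp f (idc Y) A = eq_hom e;
  pf_assoc : forall (W X Y Z : C) (f : Hom W X) (g : Hom X Y) (h : Hom Y Z)
      (A : pf_fib Z) (e : pf_map (h ∘ g ∘ f) A = pf_map (h ∘ (g ∘ f)) A),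
    pf_comp (g ∘ f) h A ∘ pf_comp f g (pf_map h A)
    = eq_hom e ∘ pf_comp f (h ∘ g) A ∘ fmap (pf_map f) (pf_comp g h A)
}.

Arguments pf_map {_} _ {_ _} _.
Arguments pf_comp {_} _ {_ _ _} _ _.

#[projections(primitive=no)]
Record IsPseudonatural (C : Category) (F G : Pseudofunctor C)
    (T : forall X, Functor (F X) (G X))
    (Tf : forall (X Y : C) (f : Hom X Y),
      NatIso (T X ∘F pf_map F f) (pf_map G f ∘F T Y)) : Prop := {
  psn_id : forall (X : C) (A : F X)
      (e : T X (pf_map F (idc X) A) = pf_map G (idc X) (T X A)),
    Tf X X (idc X) A = eq_hom e;
  psn_comp : forall (X Y Z : C) (f : Hom X Y) (g : Hom Y Z) (A : F Z),
    Tf X Z (g ∘ f) A ∘ fmap (T X) (pf_comp F f g A)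
    = pf_comp G f g (T Z A) ∘ fmap (pf_map G f) (Tf Y Z g A) ∘ Tf X Y f (pf_map F g A)
}.

Record Pseudonat (C : Category) (F G : Pseudofunctor C) := {
  pn_fun :> forall X, Functor (F X) (G X);
  pn_iso : forall (X Y : C) (f : Hom X Y),
    NatIso (pn_fun X ∘F pf_map F f) (pf_map G f ∘F pn_fun Y);
  pn_law : IsPseudonatural pn_iso
}.

Arguments pn_iso {_ _ _} _ {_ _} _.

Record Modification (C : Category) (F G : Pseudofunctor C) (S T : Pseudonat F G) := {
  md :> forall X, NatTrans (S X) (T X);
  md_law : forall (X Y : C) (f : Hom X Y) (A : F Y),
    fmap (pf_map G f) (md Y A) ∘ pn_iso S f A = pn_iso T f A ∘ md X (pf_map F f A)
}.

(** * The 2-category [Bicat(C^op, Cat)] *)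

Lemma functor_eq (D E : Category) (ob : D -> E)
    (m : forall A B, Hom A B -> Hom (ob A) (ob B)) i c i' c' :
  Build_Functor (fmap := m) i c = Build_Functor (fmap := m) i' c'.
Proof. now rewrite (proof_irrelevance _ i i'), (proof_irrelevance _ c c'). Qed.

Lemma nat_trans_eq (D E : Category) (F G : Functor D E) (a b : NatTrans F G) :
  (forall A, a A = b A) -> a = b.
Proof.
destruct a as [a na], b as [b nb]; cbn; intros e.
assert (e' : a = b) by now apply functional_extensionality_dep.
subst b; now rewrite (proof_irrelevance _ na nb).
Qed.

Lemma nat_iso_eq (D E : Category) (F G : Functor D E) (a b : NatIso F G) :
  (forall A, a A = b A) -> a = b.
Proof.
destruct a as [a a' la ra], b as [b b' lb rb]; cbn; intros e.
assert (e1 : a = b) by now apply nat_trans_eq.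
subst b.
assert (e2 : a' = b').
{ apply nat_trans_eq; intros A.
  now rewrite <- (comp_id_r (a' A)), <- (rb A), comp_assoc, la, comp_id_l. }
subst b'; now rewrite (proof_irrelevance _ la lb), (proof_irrelevance _ ra rb).
Qed.

Lemma modification_eq (C : Category) (F G : Pseudofunctor C) (S T : Pseudonat F G)
    (a b : Modification S T) :
  (forall X A, a X A = b X A) -> a = b.
Proof.
destruct a as [a la], b as [b lb]; cbn; intros e.
assert (e' : a = b).
{ apply functional_extensionality_dep; intros X; now apply nat_trans_eq. }
subst b; now rewrite (proof_irrelevance _ la lb).
Qed.

Lemma eq_hom_refl (D : Category) (A : D) (e : A = A) : eq_hom e = idc A.
Proof. now rewrite (proof_irrelevance _ e eq_refl). Qed.

Lemma fmap_eq_hom (D E : Category) (F : Functor D E) (A B : D) (e : A = B)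
    (e' : F A = F B) : fmap F (eq_hom e) = eq_hom e'.
Proof. destruct e; cbn; rewrite (eq_hom_refl e'); apply fmap_id. Qed.

Lemma eq_hom_comp (D : Category) (A B B' : D) (e : B = B') (e' : A = B) (e'' : A = B') :
  eq_hom e ∘ eq_hom e' = eq_hom e''.
Proof. destruct e, e'; rewrite (eq_hom_refl e''); apply comp_id_l. Qed.

Lemma pseudonat_eq (C : Category) (F G : Pseudofunctor C) (S T : Pseudonat F G)
    (e : forall X, pn_fun S X = pn_fun T X) :
  (forall (X Y : C) (f : Hom X Y) A,
     eq_hom (f_equal (fun H : Functor (F Y) (G Y) => pf_map G f (H A)) (e Y))
       ∘ pn_iso S f A
     = pn_iso T f A
       ∘ eq_hom (f_equal (fun H : Functor (F X) (G X) => H (pf_map F f A)) (e X))) ->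
  S = T.
Proof.
destruct S as [S Sf Sl], T as [T Tf Tl]; cbn in *; intros h.
assert (e' : S = T) by now apply functional_extensionality_dep.
subst T.
assert (e' : Sf = Tf).
{ apply functional_extensionality_dep; intros X.
  apply functional_extensionality_dep; intros Y.
  apply functional_extensionality_dep; intros f.
  apply nat_iso_eq; intros A.
  specialize (h X Y f A); rewrite !eq_hom_refl, comp_id_l, comp_id_r in h.
  exact h. }
subst Tf; now rewrite (proof_irrelevance _ Sl Tl).
Qed.

Lemma comp_cancel (D : Category) (A B B' E : D) (a : Hom B E) (b : Hom B' B)
    (b' : Hom B B') (d : Hom A B) :
  b ∘ b' = idc B -> (a ∘ b) ∘ (b' ∘ d) = a ∘ d.
Proof. intros e; now rewrite <- comp_assoc, (comp_assoc b), e, comp_id_l. Qed.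

Ltac cbn_rewrite t := let h := fresh in pose proof t as h; cbn in h; rewrite h; clear h.

Section Bicat.
Variable C : Category.

Program Definition md_id (F G : Pseudofunctor C) (S : Pseudonat F G) : Modification S S :=
  {| md := fun X => {| nt := fun A => idc (S X A) |} |}.
Next Obligation. now rewrite comp_id_l, comp_id_r. Qed.
Next Obligation. now rewrite fmap_id, comp_id_l, comp_id_r. Qed.

Program Definition md_comp (F G : Pseudofunctor C) (S T U : Pseudonat F G)
    (b : Modification T U) (a : Modification S T) : Modification S U :=
  {| md := fun X => {| nt := fun A => b X A ∘ a X A |} |}.
Next Obligation.
now rewrite <- comp_assoc, nt_nat, comp_assoc, nt_nat, <- comp_assoc.
Qed.
Next Obligation.
pose proof (md_law a f A) as ha; pose proof (md_law b f A) as hb; cbn in ha, hb.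
now rewrite fmap_comp, <- comp_assoc, ha, comp_assoc, hb, <- comp_assoc.
Qed.

Program Definition pseudonat_cat (F G : Pseudofunctor C) : Category :=
  {| Ob := Pseudonat F G; Hom := @Modification C F G; idc := @md_id F G;
     comp := @md_comp F G |}.
Next Obligation. apply modification_eq; intros Z U; apply comp_id_l. Qed.
Next Obligation. apply modification_eq; intros Z U; apply comp_id_r. Qed.
Next Obligation. apply modification_eq; intros Z U; apply comp_assoc. Qed.

Program Definition Fid_swap (D E : Category) (H : Functor D E) :
    NatIso (Fid E ∘F H) (H ∘F Fid D) :=
  {| niso := {| nt := fun A => idc (H A) |} : NatTrans (Fid E ∘F H) (H ∘F Fid D);
     niso_inv := {| nt := fun A => idc (H A) |} : NatTrans (H ∘F Fid D) (Fid E ∘F H) |}.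
Solve All Obligations with now intros; cbn; rewrite ?comp_id_l, ?comp_id_r.

Program Definition pn_id (F : Pseudofunctor C) : Pseudonat F F :=
  {| pn_fun := fun X => Fid (F X); pn_iso := fun X Y f => Fid_swap (pf_map F f) |}.
Next Obligation.
split; cbn; intros.
- now rewrite eq_hom_refl.
- now rewrite fmap_id, !comp_id_l, !comp_id_r.
Qed.

(** The cell at [f] is [S_X (T_X (F f A)) -> S_X (G f (T_Y A)) -> H f (S_Y (T_Y A))]. *)
Program Definition pn_comp_iso (F G H : Pseudofunctor C) (S : Pseudonat G H)
    (T : Pseudonat F G) (X Y : C) (f : Hom X Y) :
    NatIso ((S X ∘F T X) ∘F pf_map F f) (pf_map H f ∘F (S Y ∘F T Y)) :=
  {| niso := {| nt := fun A => pn_iso S f (T Y A) ∘ fmap (S X) (pn_iso T f A) |};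
     niso_inv := {| nt := fun A =>
       fmap (S X) (niso_inv (pn_iso T f) A) ∘ niso_inv (pn_iso S f) (T Y A) |} |}.
Next Obligation.
rewrite <- comp_assoc, <- fmap_comp.
cbn_rewrite (nt_nat (pn_iso T f) f0).
rewrite fmap_comp, !comp_assoc.
now cbn_rewrite (nt_nat (pn_iso S f) (fmap (T Y) f0)).
Qed.
Next Obligation.
rewrite <- comp_assoc.
cbn_rewrite (nt_nat (niso_inv (pn_iso S f)) (fmap (T Y) f0)).
rewrite !comp_assoc, <- !fmap_comp.
now cbn_rewrite (nt_nat (niso_inv (pn_iso T f)) f0).
Qed.
Next Obligation.
eapply eq_trans; [apply comp_cancel, (niso_inv_l (pn_iso S f)) |].
rewrite <- fmap_comp; cbn_rewrite (niso_inv_l (pn_iso T f) A); apply fmap_id.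
Qed.
Next Obligation.
eapply eq_trans; [apply comp_cancel |].
- rewrite <- fmap_comp; cbn_rewrite (niso_inv_r (pn_iso T f) A); apply fmap_id.
- apply (niso_inv_r (pn_iso S f)).
Qed.

Program Definition pn_comp (F G H : Pseudofunctor C) (S : Pseudonat G H)
    (T : Pseudonat F G) : Pseudonat F H :=
  {| pn_fun := fun X => S X ∘F T X; pn_iso := pn_comp_iso S T |}.
Next Obligation.
destruct (pn_law S) as [Sid Scomp], (pn_law T) as [Tid Tcomp].
split; cbn.
- intros X A e.
  assert (eF : pf_map F (idc X) A = A) by now rewrite (pf_id F X).
  assert (eG : pf_map G (idc X) (T X A) = T X A) by now rewrite (pf_id G X).
  assert (eH : pf_map H (idc X) (S X (T X A)) = S X (T X A)) by now rewrite (pf_id H X).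
  assert (e1 : T X (pf_map F (idc X) A) = pf_map G (idc X) (T X A)) by congruence.
  assert (e2 : S X (pf_map G (idc X) (T X A)) = pf_map H (idc X) (S X (T X A))) by congruence.
  rewrite (Sid X (T X A) e2), (Tid X A e1).
  rewrite (@fmap_eq_hom _ _ (S X) _ _ e1 (f_equal (fob (S X)) e1)).
  apply eq_hom_comp.
- intros X Y Z f g A.
  rewrite <- comp_assoc, <- fmap_comp.
  cbn_rewrite (Tcomp X Y Z f g A).
  rewrite !fmap_comp, !comp_assoc.
  cbn_rewrite (Scomp X Y Z f g (T Z A)).
  rewrite <- !comp_assoc; do 2 f_equal; rewrite !comp_assoc; f_equal.
  exact (nt_nat (pn_iso S f) (pn_iso T g A)).
Qed.

Program Definition md_wl (F G H : Pseudofunctor C) (S : Pseudonat G H)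
    (T T' : Pseudonat F G) (a : Modification T T') :
    Modification (pn_comp S T) (pn_comp S T') :=
  {| md := fun X => {| nt := fun A => fmap (S X) (a X A) |} |}.
Next Obligation. now rewrite <- !fmap_comp, nt_nat. Qed.
Next Obligation.
rewrite comp_assoc.
eapply eq_trans; [apply f_equal2; [symmetry; apply (nt_nat (pn_iso S f)) | reflexivity] |].
cbn; rewrite <- !comp_assoc, <- !fmap_comp.
now cbn_rewrite (md_law a f A).
Qed.

Program Definition md_wr (F G H : Pseudofunctor C) (S S' : Pseudonat G H)
    (a : Modification S S') (T : Pseudonat F G) :
    Modification (pn_comp S T) (pn_comp S' T) :=
  {| md := fun X => {| nt := fun A => a X (T X A) |} |}.
Next Obligation. apply nt_nat. Qed.
Next Obligation.
rewrite comp_assoc; cbn_rewrite (md_law a f (T Y A)).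
rewrite <- !comp_assoc; f_equal; apply nt_nat.
Qed.

Lemma pn_comp_id_l (F G : Pseudofunctor C) (T : Pseudonat F G) : pn_comp (pn_id G) T = T.
Proof.
unshelve eapply pseudonat_eq; cbn; intros.
- apply functor_eq.
- now rewrite !eq_hom_refl, !comp_id_l, comp_id_r.
Qed.

Lemma pn_comp_id_r (F G : Pseudofunctor C) (T : Pseudonat F G) : pn_comp T (pn_id F) = T.
Proof.
unshelve eapply pseudonat_eq; cbn; intros.
- apply functor_eq.
- now rewrite !eq_hom_refl, fmap_id, !comp_id_l.
Qed.

Lemma pn_comp_assoc (F G H I : Pseudofunctor C) (U : Pseudonat H I) (S : Pseudonat G H)
    (T : Pseudonat F G) :
  pn_comp U (pn_comp S T) = pn_comp (pn_comp U S) T.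
Proof.
unshelve eapply pseudonat_eq; cbn; intros.
- apply functor_eq.
- now rewrite !eq_hom_refl, comp_id_l, comp_id_r, fmap_comp, comp_assoc.
Qed.

Lemma md_eq_hom (F G : Pseudofunctor C) (S T : pseudonat_cat F G) (e : S = T) (X : C)
    (A : F X) (e' : pn_fun S X A = pn_fun T X A) :
  md (eq_hom e) X A = eq_hom e'.
Proof. destruct e; cbn; now rewrite (eq_hom_refl e'). Qed.

Ltac eq_hom_cells :=
  apply modification_eq; intros; cbn;
  repeat match goal with
  | |- context [nt (md (eq_hom ?e) ?X) ?A] =>
      rewrite (@md_eq_hom _ _ _ _ e X A eq_refl); cbn
  end;
  now rewrite comp_id_l, comp_id_r.

Program Definition Bicat : TwoCategory :=
  {| cell0 := Pseudofunctor C; cell1 := pseudonat_cat; id1 := pn_id;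
     comp1 := pn_comp; wl := md_wl; wr := md_wr; comp1_id_l := pn_comp_id_l;
     comp1_id_r := pn_comp_id_r; comp1_assoc := pn_comp_assoc |}.
Next Obligation. apply modification_eq; intros; cbn; apply fmap_id. Qed.
Next Obligation. apply modification_eq; intros; cbn; apply fmap_comp. Qed.
Next Obligation. now apply modification_eq. Qed.
Next Obligation. now apply modification_eq. Qed.
Next Obligation. apply modification_eq; intros; cbn; symmetry; apply nt_nat. Qed.
Next Obligation. eq_hom_cells. Qed.
Next Obligation. eq_hom_cells. Qed.
Next Obligation. eq_hom_cells. Qed.
Next Obligation. eq_hom_cells. Qed.
Next Obligation. eq_hom_cells. Qed.
End Bicat.

(** * Tangent indexing functors *)

Section Indexing.
Variables (C : Category) (F : Pseudofunctor C).

Record IndexingData := {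
  ix_tan : forall X, TangentData (F X);
  ix_iso : forall (X Y : C) (f : Hom X Y),
    NatIso (pf_map F f ∘F tT (ix_tan Y)) (tT (ix_tan X) ∘F pf_map F f)
}.

#[projections(primitive=no)]
Record IsTangentIndexing (d : IndexingData) : Prop := {
  ti_fibre : forall X, IsTangentStructure (ix_tan d X);
  ti_strong : forall (X Y : C) (f : Hom X Y), IsStrongTangentMorphism (ix_iso d f);
  ti_pseudonat : IsPseudonatural (F := F) (G := F) (T := fun X => tT (ix_tan d X))
    (fun X Y f => niso_sym (ix_iso d f))
}.

Definition tuple_data (t : TangentTuple (K := Bicat C) F) : IndexingData :=
  let T : Pseudonat F F := oT t in
  let T2 : Pseudonat F F := oT2 t in
  let pi1 : Modification T2 T := opi1 t in
  let pi2 : Modification T2 T := opi2 t in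
  let p : Modification T (pn_id F) := op t in
  let zero : Modification (pn_id F) T := ozero t in
  let add : Modification T2 T := oadd t in
  let lift : Modification T (pn_comp T T) := olift t in
  let flip : Modification (pn_comp T T) (pn_comp T T) := oflip t in
  {| ix_tan := fun X =>
       {| tT := T X; tT2 := T2 X; tpi1 := pi1 X; tpi2 := pi2 X; tp := p X;
          tzero := zero X; tadd := add X; tlift := lift X; tflip := flip X |};
     ix_iso := fun X Y f => niso_sym (pn_iso T f) |}.

End Indexing.

(* Main.v *)
(** In both directions the point is that a limit in the hom-category of
    pseudonatural transformations is the same as a limit in every fibre.

    Fibrewise limits give (pointwise) limits because the comparison cells of the
    1-cells involved are isomorphisms: reindexing along [f] then preserves the
    fibrewise limit, which makes fibrewise mediating maps into a modification.
    Conversely, an object [A] of [F X] is named by a 1-cell out of the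
    representable of [X], and a pointwise limit stays a limit after precomposition
    with this 1-cell; by the Yoneda lemma this yields the limit at [A].

    Equations between 2-cells are componentwise, the modification laws of the
    structure cells are the axioms of a tangent morphism after inverting the
    comparison cells, and the pullback of [T p] along [0] is the equalizer of
    [T p] and [0 p p_T] because [0] is a section of [p]. *)
From Stdlib Require Import FunctionalExtensionality ProofIrrelevance IndefiniteDescription.
From Stdlib Require Fin.
Require Import Defs.

Set Implicit Arguments.
Unset Strict Implicit.
Set Primitive Projections.

(** * Wide pullbacks *)

(** Covers [IsPullbackPower] (by conversion) and [IsPullback] ([pullback_wide]). *)
Definition IsWidePullback (D : Category) (I : Type) (Q : D) (P : I -> D)
    (p : forall i, Hom (P i) Q) (L : D) (b : Hom L Q) (pr : forall i, Hom L (P i)) : Prop :=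
  (forall i, p i ∘ pr i = b) /\
  forall (Z : D) (z : Hom Z Q) (zs : forall i, Hom Z (P i)),
    (forall i, p i ∘ zs i = z) ->
    exists! u : Hom Z L, b ∘ u = z /\ forall i, pr i ∘ u = zs i.

(** The two legs of a pullback have different sources, so a cospan is encoded as a family over
    [bool] whose source objects depend on the index. *)
Definition bool_fam (D : Category) (A B : D) (i : bool) : D := if i then A else B.

Definition bool_into (D : Category) (A B Q : D) (f : Hom A Q) (g : Hom B Q) (i : bool) :
    Hom (bool_fam A B i) Q :=
  match i with true => f | false => g end.

Definition bool_from (D : Category) (A B L : D) (f : Hom L A) (g : Hom L B) (i : bool) :
    Hom L (bool_fam A B i) :=
  match i with true => f | false => g end.

(** The diagonal [b] is a separate variable, determined by [f ∘ l1 = b], so that it can take another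
    form, such as the image under a functor of a composite. *)
Lemma pullback_wide (D : Category) (A B Q : D) (f : Hom A Q) (g : Hom B Q)
    (L : D) (l1 : Hom L A) (l2 : Hom L B) (b : Hom L Q) :
  f ∘ l1 = b ->
  IsPullback f g l1 l2 <-> IsWidePullback (bool_into f g) b (bool_from l1 l2).
Proof.
intros eb; split; intros [e H]; split.
- intros []; cbn; congruence.
- intros Z z zs ez.
  destruct (H Z (zs true) (zs false)) as [u [[e1 e2] hu]].
  { exact (eq_trans (ez true) (eq_sym (ez false))). }
  exists u; split.
  + split.
    * rewrite <- eb, <- comp_assoc, e1; apply (ez true).
    * intros []; assumption.
  + intros v [_ hv]; apply hu; split; [apply (hv true) | apply (hv false)].
- exact (eq_trans (e true) (eq_sym (e false))).
- intros Z z1 z2 ez.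
  destruct (H Z (f ∘ z1) (bool_from z1 z2)) as [u [[e1 e2] hu]].
  { intros []; cbn; congruence. }
  exists u; split; [split; [apply (e2 true) | apply (e2 false)] |].
  intros v [h1 h2]; apply hu; split.
  + rewrite <- eb, <- comp_assoc; congruence.
  + intros []; assumption.
Qed.

(** Computes on both closed indices, so that [pairing] reduces to its entries by conversion. *)
Definition fin2_rect (P : Fin.t 2 -> Type) (p0 : P Fin.F1) (p1 : P (Fin.FS Fin.F1)) i : P i :=
  Fin.caseS' i P p0 (fun j => Fin.caseS' j (fun j => P (Fin.FS j)) p1
    (fun k => Fin.case0 (fun k => P (Fin.FS (Fin.FS k))) k)).

Definition pairing (X : Type) (x y : X) (i : Fin.t 2) : X := fin2_rect (P := fun _ => X) x y i.

Lemma pullback_power2 (D : Category) (P Q : D) (p : Hom P Q) (L : D) (l1 l2 : Hom L P)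
    (b : Hom L Q) :
  p ∘ l1 = b -> IsPullback p p l1 l2 <-> IsPullbackPower p b (pairing l1 l2).
Proof.
intros eb; split; intros [e H]; split.
- intros i; pattern i; apply fin2_rect; cbn; congruence.
- intros Z z zs ez.
  destruct (H Z (zs Fin.F1) (zs (Fin.FS Fin.F1))) as [u [[e1 e2] hu]].
  { exact (eq_trans (ez Fin.F1) (eq_sym (ez (Fin.FS Fin.F1)))). }
  exists u; split.
  + split; [rewrite <- eb, <- comp_assoc, e1; apply ez |].
    intros i; pattern i; apply fin2_rect; assumption.
  + intros v [_ hv]; apply hu; split; [apply (hv Fin.F1) | apply (hv (Fin.FS Fin.F1))].
- exact (eq_trans (e Fin.F1) (eq_sym (e (Fin.FS Fin.F1)))).
- intros Z z1 z2 ez.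
  destruct (H Z (p ∘ z1) (pairing z1 z2)) as [u [[e1 e2] hu]].
  { intros i; pattern i; apply fin2_rect; cbn; congruence. }
  exists u; split; [split; [apply (e2 Fin.F1) | apply (e2 (Fin.FS Fin.F1))] |].
  intros v [h1 h2]; apply hu; split.
  + rewrite <- eb, <- comp_assoc; congruence.
  + intros i; pattern i; apply fin2_rect; assumption.
Qed.

Record Iso (D : Category) (A B : D) := {
  iso_fwd : Hom A B;
  iso_bwd : Hom B A;
  iso_fb : iso_fwd ∘ iso_bwd = idc B;
  iso_bf : iso_bwd ∘ iso_fwd = idc A
}.

Lemma iso_mono (D : Category) (A B Z : D) (a : Iso A B) (u v : Hom Z A) :
  iso_fwd a ∘ u = iso_fwd a ∘ v -> u = v.
Proof.
intros e; now rewrite <- (comp_id_l u), <- (comp_id_l v), <- (iso_bf a), <- !comp_assoc, e.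
Qed.

Lemma iso_epi (D : Category) (A B Z : D) (a : Iso A B) (u v : Hom B Z) :
  u ∘ iso_fwd a = v ∘ iso_fwd a -> u = v.
Proof.
intros e; now rewrite <- (comp_id_r u), <- (comp_id_r v), <- (iso_fb a), !comp_assoc, e.
Qed.

Section WidePullback.
Variables (D : Category) (I : Type) (Q : D) (P : I -> D) (p : forall i, Hom (P i) Q).

Lemma wide_pullback_ext (L : D) (b b' : Hom L Q) (pr pr' : forall i, Hom L (P i))
    (p' : forall i, Hom (P i) Q) :
  (forall i, p i = p' i) -> b = b' -> (forall i, pr i = pr' i) ->
  IsWidePullback p b pr -> IsWidePullback p' b' pr'.
Proof.
intros ep <- epr.
apply functional_extensionality_dep in ep; apply functional_extensionality_dep in epr.
now subst.
Qed.

Lemma wide_pullback_mono (L : D) (b : Hom L Q) (pr : forall i, Hom L (P i)) (Z : D)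
    (u v : Hom Z L) :
  IsWidePullback p b pr -> b ∘ u = b ∘ v -> (forall i, pr i ∘ u = pr i ∘ v) -> u = v.
Proof.
intros [e H] eb epr.
destruct (H Z (b ∘ v) (fun i => pr i ∘ v)) as [w [_ hw]].
{ intros i; now rewrite comp_assoc, e. }
rewrite <- (hw u), <- (hw v); auto.
Qed.

(** Being a limit is invariant under isomorphisms of cones over isomorphic diagrams. With the
    comparison cells of pseudonatural transformations as [iQ], [iP] and [iL], this turns
    pseudonaturality into preservation of limits by reindexing. *)
Lemma wide_pullback_iso (Q' : D) (P' : I -> D) (p' : forall i, Hom (P' i) Q') (L L' : D)
    (b : Hom L Q) (pr : forall i, Hom L (P i)) (b' : Hom L' Q')
    (pr' : forall i, Hom L' (P' i))
    (iQ : Iso Q Q') (iP : forall i, Iso (P i) (P' i)) (iL : Iso L L') :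
  (forall i, p' i ∘ iso_fwd (iP i) = iso_fwd iQ ∘ p i) ->
  b' ∘ iso_fwd iL = iso_fwd iQ ∘ b ->
  (forall i, pr' i ∘ iso_fwd iL = iso_fwd (iP i) ∘ pr i) ->
  IsWidePullback p b pr -> IsWidePullback p' b' pr'.
Proof.
intros ep eb epr H; pose proof H as [e _]; split.
- intros i; apply (iso_epi (a := iL)).
  now rewrite <- comp_assoc, epr, comp_assoc, ep, <- comp_assoc, e.
- intros Z z zs ez.
  destruct (proj2 H Z (iso_bwd iQ ∘ z) (fun i => iso_bwd (iP i) ∘ zs i)) as [u [[h1 h2] _]].
  { intros i; apply (iso_mono (a := iQ)).
    now rewrite !comp_assoc, <- ep, <- (comp_assoc (p' i)), !iso_fb, comp_id_l, comp_id_r. }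
  exists (iso_fwd iL ∘ u); split; [split |].
  + now rewrite comp_assoc, eb, <- comp_assoc, h1, comp_assoc, iso_fb, comp_id_l.
  + intros i.
    now rewrite comp_assoc, epr, <- comp_assoc, h2, comp_assoc, iso_fb, comp_id_l.
  + intros v [k1 k2].
    enough (ev : u = iso_bwd iL ∘ v).
    { now rewrite ev, comp_assoc, iso_fb, comp_id_l. }
    apply (wide_pullback_mono H).
    * apply (iso_mono (a := iQ)).
      rewrite h1, !comp_assoc, <- eb, <- (comp_assoc b'), !iso_fb, comp_id_l, comp_id_r.
      easy.
    * intros i; apply (iso_mono (a := iP i)).
      rewrite h2, !comp_assoc, <- epr, <- (comp_assoc (pr' i)), !iso_fb, comp_id_l, comp_id_r.
      easy.
Qed.

Lemma wide_pullback_unique (L L' : D) (b : Hom L Q) (pr : forall i, Hom L (P i))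
    (b' : Hom L' Q) (pr' : forall i, Hom L' (P i)) :
  IsWidePullback p b pr -> IsWidePullback p b' pr' ->
  exists a : Iso L L', b' ∘ iso_fwd a = b /\ forall i, pr' i ∘ iso_fwd a = pr i.
Proof.
intros H H'.
destruct (proj2 H L' b' pr' (proj1 H')) as [v [[v1 v2] _]].
destruct (proj2 H' L b pr (proj1 H)) as [u [[u1 u2] _]].
unshelve eexists {| iso_fwd := u; iso_bwd := v |}; cbn; auto.
- apply (wide_pullback_mono H'); intros; rewrite comp_assoc, comp_id_r; congruence.
- apply (wide_pullback_mono H); intros; rewrite comp_assoc, comp_id_r; congruence.
Qed.

End WidePullback.

(** * Preservation of limits by functors *)

Definition id_iso (D : Category) (A : D) : Iso A A :=
  {| iso_fwd := idc A; iso_bwd := idc A; iso_fb := comp_id_l (idc A);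
     iso_bf := comp_id_l (idc A) |}.

Program Definition fmap_iso (D E : Category) (F : Functor D E) (A B : D) (a : Iso A B) :
    Iso (F A) (F B) :=
  {| iso_fwd := fmap F (iso_fwd a); iso_bwd := fmap F (iso_bwd a) |}.
Next Obligation. now rewrite <- fmap_comp, iso_fb, fmap_id. Qed.
Next Obligation. now rewrite <- fmap_comp, iso_bf, fmap_id. Qed.

Definition niso_at (D E : Category) (F G : Functor D E) (a : NatIso F G) (A : D) :
    Iso (F A) (G A) :=
  {| iso_fwd := a A; iso_bwd := niso_inv a A; iso_fb := niso_inv_r a A;
     iso_bf := niso_inv_l a A |}.

(** Two limit cones over the same diagram differ by an isomorphism, and [F] keeps it an isomorphism.
    The axioms assert preservation of one existing power, whereas the chosen [T2] and arbitrary
    power cones also have to be handled. *)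
Lemma preserves_any_wide_pullback (D E : Category) (F : Functor D E) (I : Type) (Q : D)
    (P : I -> D) (p : forall i, Hom (P i) Q) (L L' : D) (b : Hom L Q)
    (pr : forall i, Hom L (P i)) (b' : Hom L' Q) (pr' : forall i, Hom L' (P i)) :
  IsWidePullback p b pr -> IsWidePullback p b' pr' ->
  IsWidePullback (fun i => fmap F (p i)) (fmap F b) (fun i => fmap F (pr i)) ->
  IsWidePullback (fun i => fmap F (p i)) (fmap F b') (fun i => fmap F (pr' i)).
Proof.
intros H H' HF.
destruct (wide_pullback_unique H H') as [a [e1 e2]].
apply (wide_pullback_iso (iQ := id_iso (F Q)) (iP := fun i => id_iso (F (P i)))
  (iL := fmap_iso F a)) with (4 := HF); cbn; intros.
- now rewrite comp_id_l, comp_id_r.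
- now rewrite comp_id_l, <- fmap_comp, e1.
- now rewrite comp_id_l, <- fmap_comp, e2.
Qed.

(** The objects [F (bool_fam A B i)] and [bool_fam (F A) (F B) i] become convertible only after a
    case distinction on [i]; identities chosen by cases connect the two diagrams. *)
Lemma fmap_bool_wide (D E : Category) (F : Functor D E) (A B Q L : D) (f : Hom A Q)
    (g : Hom B Q) (b : Hom L Q) (l1 : Hom L A) (l2 : Hom L B) :
  IsWidePullback (fun i => fmap F (bool_into f g i)) (fmap F b)
    (fun i => fmap F (bool_from l1 l2 i)) <->
  IsWidePullback (bool_into (fmap F f) (fmap F g)) (fmap F b)
    (bool_from (fmap F l1) (fmap F l2)).
Proof.
set (iP := fun i => match i as i return
  Iso (F (bool_fam A B i)) (bool_fam (F A) (F B) i) with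
  true => id_iso _ | false => id_iso _ end).
set (iP' := fun i => match i as i return
  Iso (bool_fam (F A) (F B) i) (F (bool_fam A B i)) with
  true => id_iso _ | false => id_iso _ end).
split;
  [apply (wide_pullback_iso (iQ := id_iso _) (iP := iP) (iL := id_iso _))
  | apply (wide_pullback_iso (iQ := id_iso _) (iP := iP') (iL := id_iso _))];
  cbn; intros; try destruct i; cbn; now rewrite comp_id_l, comp_id_r.
Qed.

Lemma preserves_any_pullback (D E : Category) (F : Functor D E) (A B Q : D) (f : Hom A Q)
    (g : Hom B Q) (L L' : D) (l1 : Hom L A) (l2 : Hom L B) (l1' : Hom L' A)
    (l2' : Hom L' B) :
  IsPullback f g l1 l2 -> IsPullback f g l1' l2' ->
  IsPullback (fmap F f) (fmap F g) (fmap F l1) (fmap F l2) ->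
  IsPullback (fmap F f) (fmap F g) (fmap F l1') (fmap F l2').
Proof.
rewrite (pullback_wide g l2 (eq_refl (f ∘ l1))).
rewrite (pullback_wide g l2' (eq_refl (f ∘ l1'))).
rewrite (pullback_wide (fmap F g) (fmap F l2) (eq_sym (fmap_comp F f l1))).
rewrite (pullback_wide (fmap F g) (fmap F l2') (eq_sym (fmap_comp F f l1'))).
rewrite <- !fmap_bool_wide.
apply preserves_any_wide_pullback.
Qed.

(** Composing [f ∘ y1 = z ∘ y2] with the retraction [p] of [z] gives [y2 = r ∘ y1], so the second
    leg of a cone is determined by the first. *)
Lemma pullback_equalizer (D : Category) (A B E L : D) (f : Hom B E) (z : Hom A E)
    (p : Hom E A) (r : Hom B A) (l : Hom L B) (w : Hom L A) :
  p ∘ z = idc A -> p ∘ f = r -> r ∘ l = w ->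
  IsPullback f z l w <-> IsEqualizer f (z ∘ r) l.
Proof.
intros ez ef <-; split; intros [e H]; split.
- now rewrite <- comp_assoc.
- intros Z y ey; destruct (H Z y (r ∘ y)) as [u [[u1 u2] hu]].
  { now rewrite ey, comp_assoc. }
  exists u; split; [exact u1 |]; intros v <-; apply hu; split; auto.
  now rewrite comp_assoc.
- now rewrite comp_assoc.
- intros Z y1 y2 ey.
  assert (e2 : r ∘ y1 = y2).
  { now rewrite <- ef, <- comp_assoc, ey, comp_assoc, ez, comp_id_l. }
  subst y2; destruct (H Z y1) as [u [u1 hu]].
  { now rewrite ey, comp_assoc. }
  exists u; split; [split; [exact u1 | now rewrite <- comp_assoc, u1] |].
  intros v [v1 _]; now apply hu.
Qed.

(** * Pairings and commutative monoids *)

Lemma pullback_pair (D : Category) (A B Q L Z : D) (f : Hom A Q) (g : Hom B Q)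
    (l1 : Hom L A) (l2 : Hom L B) (z1 : Hom Z A) (z2 : Hom Z B) :
  IsPullback f g l1 l2 -> f ∘ z1 = g ∘ z2 -> exists u, l1 ∘ u = z1 /\ l2 ∘ u = z2.
Proof. intros [_ H] e; destruct (H Z z1 z2 e) as [u [hu _]]; now exists u. Qed.

Lemma pullback_mono (D : Category) (A B Q L Z : D) (f : Hom A Q) (g : Hom B Q)
    (l1 : Hom L A) (l2 : Hom L B) (u v : Hom Z L) :
  IsPullback f g l1 l2 -> l1 ∘ u = l1 ∘ v -> l2 ∘ u = l2 ∘ v -> u = v.
Proof.
intros [e H] e1 e2; destruct (H Z (l1 ∘ v) (l2 ∘ v)) as [w [_ hw]].
{ now rewrite !comp_assoc, e. }
rewrite <- (hw u), <- (hw v); auto.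
Qed.

(** The monoid laws hold for all generalized elements as soon as they hold for
    the universal ones, which live over [P], [E2] and the triple power. *)
Lemma comm_monoid_functor (D E : Category) (F : Functor D E) (A P E2 : D) (p : Hom P A)
    (pi1 pi2 : Hom E2 P) (zero : Hom A P) (add : Hom E2 P) (E3 : D) (b : Hom E3 A)
    (pr : Fin.t 3 -> Hom E3 P) :
  IsCommMonoidOver p pi1 pi2 zero add ->
  IsPullback (fmap F p) (fmap F p) (fmap F pi1) (fmap F pi2) ->
  IsPullbackPower p b pr ->
  IsPullbackPower (fmap F p) (fmap F b) (fun i => fmap F (pr i)) ->
  IsCommMonoidOver (fmap F p) (fmap F pi1) (fmap F pi2) (fmap F zero) (fmap F add).
Proof.
intros M H2 H3 H3'; pose proof (cm_product M) as M2.
assert (eq2 : p ∘ pi1 = p ∘ pi2) by apply M2.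
split.
- exact H2.
- now rewrite <- fmap_comp, (cm_zero_over M), fmap_id.
- now rewrite <- !fmap_comp, (cm_add_over M).
- intros Z u e.
  (* [u0] is the universal pair (0, x); the hypothesis on [u] says that [u] factors through its
     image. *)
  destruct (pullback_pair (z1 := zero ∘ p) (z2 := idc P) M2) as [u0 [u1 u2]].
  { now rewrite comp_assoc, (cm_zero_over M), comp_id_l, comp_id_r. }
  assert (eu : u = fmap F u0 ∘ (fmap F pi2 ∘ u)).
  { apply (pullback_mono H2); rewrite !comp_assoc, <- fmap_comp.
    - now rewrite u1, fmap_comp.
    - now rewrite u2, fmap_id, comp_id_l. }
  rewrite eu, !comp_assoc, <- !fmap_comp, (cm_unit M); [reflexivity |].
  now rewrite u1, <- comp_assoc, u2, comp_id_r.
- intros Z u v e1 e2.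
  (* [s] swaps the two factors, and [v] is [u] followed by the image of this swap. *)
  destruct (pullback_pair (z1 := pi2) (z2 := pi1) M2) as [s [s1 s2]]; [easy |].
  assert (ev : v = fmap F s ∘ u).
  { apply (pullback_mono H2); rewrite comp_assoc, <- fmap_comp; congruence. }
  rewrite ev, comp_assoc, <- fmap_comp, (cm_comm M (u := idc E2)); rewrite ?comp_id_r; auto.
- intros Z xy yz xy_z x_yz e1 e2 e3 e4 e5.
  set (x := pr Fin.F1); set (y := pr (Fin.FS Fin.F1)); set (z := pr (Fin.FS (Fin.FS Fin.F1))).
  assert (ex : p ∘ x = b) by apply H3.
  assert (ey : p ∘ y = b) by apply H3.
  assert (ez : p ∘ z = b) by apply H3.
  destruct (pullback_pair (z1 := x) (z2 := y) M2) as [XY [hXY1 hXY2]]; [congruence |].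
  destruct (pullback_pair (z1 := y) (z2 := z) M2) as [YZ [hYZ1 hYZ2]]; [congruence |].
  destruct (pullback_pair (z1 := add ∘ XY) (z2 := z) M2) as [XY_Z [h1 h2]].
  { rewrite comp_assoc, (cm_add_over M), <- comp_assoc; congruence. }
  destruct (pullback_pair (z1 := x) (z2 := add ∘ YZ) M2) as [X_YZ [h3 h4]].
  { rewrite comp_assoc, (cm_add_over M), <- comp_assoc; congruence. }
  assert (eqF : fmap F p ∘ fmap F pi1 = fmap F p ∘ fmap F pi2) by apply H2.
  assert (a1 : fmap F p ∘ (fmap F pi1 ∘ xy) = fmap F p ∘ (fmap F pi2 ∘ xy)).
  { now rewrite !comp_assoc, eqF. }
  assert (a2 : fmap F p ∘ (fmap F pi1 ∘ yz) = fmap F p ∘ (fmap F pi2 ∘ yz)).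
  { now rewrite !comp_assoc, eqF. }
  (* [w] is the generalized element (x, y, z) of the image of the triple power, with (x, y) given by
     [xy] and z by the second component of [yz]. All four given pairs factor through it. *)
  destruct (proj2 H3' Z (fmap F p ∘ (fmap F pi1 ∘ xy))
    (fun i => Fin.caseS' i (fun _ => _) (fmap F pi1 ∘ xy)
      (pairing (fmap F pi2 ∘ xy) (fmap F pi2 ∘ yz)))) as [w [[_ hw] _]].
  { intros i; apply (Fin.caseS' i); [easy | intros j; pattern j; apply fin2_rect; cbn; congruence]. }
  pose proof (hw Fin.F1) as w1; pose proof (hw (Fin.FS Fin.F1)) as w2;
    pose proof (hw (Fin.FS (Fin.FS Fin.F1))) as w3; cbn in w1, w2, w3.
  fold x in w1; fold y in w2; fold z in w3.
  assert (exy : xy = fmap F XY ∘ w).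
  { apply (pullback_mono H2); rewrite comp_assoc, <- fmap_comp; congruence. }
  assert (eyz : yz = fmap F YZ ∘ w).
  { apply (pullback_mono H2); rewrite comp_assoc, <- fmap_comp; congruence. }
  assert (exy_z : xy_z = fmap F XY_Z ∘ w).
  { apply (pullback_mono H2); rewrite comp_assoc, <- fmap_comp; [| congruence].
    now rewrite h1, fmap_comp, <- comp_assoc, <- exy. }
  assert (ex_yz : x_yz = fmap F X_YZ ∘ w).
  { apply (pullback_mono H2); rewrite comp_assoc, <- fmap_comp; [congruence |].
    now rewrite h4, fmap_comp, <- comp_assoc, <- eyz. }
  rewrite exy_z, ex_yz, !comp_assoc, <- !fmap_comp.
  rewrite (cm_assoc M (xy := XY) (yz := YZ) (xy_z := XY_Z) (x_yz := X_YZ)); congruence.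
Qed.

(** * Fibrewise limits of pseudonatural transformations *)

(** [G0] and [F0] stand for reindexing along an identity. As variables they can be replaced by the
    identity functors, to which reindexing is only propositionally equal. *)
Lemma nt_eq_hom (D E : Category) (L S : Functor D E) (m : NatTrans L S) (G0 : Functor D D)
    (F0 : Functor E E) (A : D) (e : L (G0 A) = F0 (L A)) (e' : S (G0 A) = F0 (S A)) :
  G0 = Fid D -> F0 = Fid E ->
  fmap F0 (m A) ∘ eq_hom e = eq_hom e' ∘ m (G0 A).
Proof.
intros -> ->; cbn in *; now rewrite !eq_hom_refl, comp_id_l, comp_id_r.
Qed.

Program Definition nat_iso_of (D E : Category) (F G : Functor D E)
    (a : forall A, Iso (F A) (G A))
    (n : forall A B (f : Hom A B),
      iso_fwd (a B) ∘ fmap F f = fmap G f ∘ iso_fwd (a A)) : NatIso F G :=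
  {| niso := {| nt := fun A => iso_fwd (a A); nt_nat := n |};
     niso_inv := {| nt := fun A => iso_bwd (a A) |};
     niso_inv_l := fun A => iso_bf (a A); niso_inv_r := fun A => iso_fb (a A) |}.
Next Obligation.
apply (iso_mono (a := a B)).
now rewrite !comp_assoc, n, iso_fb, comp_id_l, <- comp_assoc, iso_fb, comp_id_r.
Qed.

Section Fibrewise.
Variables (C : Category) (G F : Pseudofunctor C).

Section Modifications.
Variables (I : Type) (Q : Pseudonat G F) (P : I -> Pseudonat G F)
  (p : forall i, Modification (P i) Q).

(** The comparison cells at [f] are isomorphisms from the cone at the reindexed object to the image
    of the cone at [A]; their compatibility with the cone maps is the modification law. *)
Lemma fibrewise_preserved (L : Pseudonat G F) (b : Modification L Q)
    (pr : forall i, Modification L (P i)) :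
  (forall X A, IsWidePullback (fun i => p i X A) (b X A) (fun i => pr i X A)) ->
  forall (X Y : C) (f : Hom X Y) (A : G Y),
    IsWidePullback (fun i => fmap (pf_map F f) (p i Y A)) (fmap (pf_map F f) (b Y A))
      (fun i => fmap (pf_map F f) (pr i Y A)).
Proof.
intros H X Y f A.
apply (wide_pullback_iso (iQ := niso_at (pn_iso Q f) A)
  (iP := fun i => niso_at (pn_iso (P i) f) A) (iL := niso_at (pn_iso L f) A))
  with (4 := H X (pf_map G f A)); cbn; intros; apply md_law.
Qed.

(** Mediating maps are chosen in every fibre. Naturality and the modification law are then tested on
    the projections of a limit cone: in the fibre for the former, and in the image under reindexing
    for the latter. *)
Lemma fibrewise_wide_pullback (L : Pseudonat G F) (b : Modification L Q)
    (pr : forall i, Modification L (P i)) :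
  (forall X A, IsWidePullback (fun i => p i X A) (b X A) (fun i => pr i X A)) ->
  IsWidePullback (D := pseudonat_cat G F) (Q := Q) (P := P) p b pr.
Proof.
intros H; pose proof (fibrewise_preserved H) as HF; split.
- intros i; apply modification_eq; intros X A; apply (H X A).
- intros Z z zs ez.
  change (Pseudonat G F) in Z; change (Modification Z Q) in z;
    change (forall i, Modification Z (P i)) in zs.
  assert (ez' : forall i X A, p i X A ∘ zs i X A = z X A).
  { intros i X A; now rewrite <- (ez i). }
  assert (K : forall X A, exists u : Hom (Z X A) (L X A),
    b X A ∘ u = z X A /\ forall i, pr i X A ∘ u = zs i X A).
  { intros X A; destruct (proj2 (H X A) _ (z X A) (fun i => zs i X A)) as [u [hu _]].
    - intros i; apply ez'.
    - now exists u. }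
  set (u X A := proj1_sig (constructive_indefinite_description _ (K X A))).
  assert (ub : forall X A, b X A ∘ u X A = z X A).
  { intros X A; apply (proj2_sig (constructive_indefinite_description _ (K X A))). }
  assert (upr : forall X A i, pr i X A ∘ u X A = zs i X A).
  { intros X A; apply (proj2_sig (constructive_indefinite_description _ (K X A))). }
  clearbody u; clear K.
  assert (un : forall X A B (f : Hom A B),
    u X B ∘ fmap (Z X) f = fmap (pn_fun L X) f ∘ u X A).
  { intros X A B f; apply (wide_pullback_mono (H X B)); intros; rewrite !comp_assoc.
    - now rewrite ub, !nt_nat, <- comp_assoc, ub.
    - now rewrite upr, !nt_nat, <- comp_assoc, upr. }
  assert (um : forall X Y (f : Hom X Y) A,
    fmap (pf_map F f) (u Y A) ∘ pn_iso Z f A = pn_iso L f A ∘ u X (pf_map G f A)).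
  { intros X Y f A; apply (wide_pullback_mono (HF X Y f A)); intros;
      cbn; rewrite !comp_assoc, <- fmap_comp.
    - rewrite ub; cbn_rewrite (md_law z f A); cbn_rewrite (md_law b f A).
      now rewrite <- comp_assoc, ub.
    - rewrite upr; cbn_rewrite (md_law (zs i) f A); cbn_rewrite (md_law (pr i) f A).
      now rewrite <- comp_assoc, upr. }
  exists {| md := fun X => {| nt := u X; nt_nat := un X |} : NatTrans (Z X) (L X);
            md_law := um |}.
  split.
  + split; [| intros i]; apply modification_eq; intros X A; cbn; [apply ub | apply upr].
  + intros v [v1 v2]; apply modification_eq; intros X A; cbn.
    apply (wide_pullback_mono (H X A)); intros.
    * rewrite ub, <- v1; reflexivity.
    * rewrite upr, <- v2; reflexivity.
Qed.

(** By [HF] the image of the cone at [A] is a limit, and by [H], after transport along the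
    comparison cells of [Q] and [P i], so is the cone at the reindexed object. The cells of [L] are
    the resulting isomorphisms between two limits of one diagram, and their laws are checked on
    projections. *)
Lemma pseudonatural_cone_functor (L : forall X, Functor (G X) (F X))
    (b : forall X, NatTrans (L X) (Q X)) (pr : forall i X, NatTrans (L X) (P i X)) :
  (forall X A, IsWidePullback (fun i => p i X A) (b X A) (fun i => pr i X A)) ->
  (forall (X Y : C) (f : Hom X Y) (A : G Y),
    IsWidePullback (fun i => fmap (pf_map F f) (p i Y A)) (fmap (pf_map F f) (b Y A))
      (fun i => fmap (pf_map F f) (pr i Y A))) ->
  exists Lf : forall (X Y : C) (f : Hom X Y),
      NatIso (L X ∘F pf_map G f) (pf_map F f ∘F L Y),
    IsPseudonatural Lf /\
    (forall X Y (f : Hom X Y) A,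
      fmap (pf_map F f) (b Y A) ∘ Lf X Y f A = pn_iso Q f A ∘ b X (pf_map G f A)) /\
    (forall i X Y (f : Hom X Y) A,
      fmap (pf_map F f) (pr i Y A) ∘ Lf X Y f A = pn_iso (P i) f A ∘ pr i X (pf_map G f A)).
Proof.
intros H HF.
assert (K : forall X Y (f : Hom X Y) A,
  exists a : Iso (L X (pf_map G f A)) (pf_map F f (L Y A)),
    fmap (pf_map F f) (b Y A) ∘ iso_fwd a = pn_iso Q f A ∘ b X (pf_map G f A) /\
    forall i, fmap (pf_map F f) (pr i Y A) ∘ iso_fwd a
      = pn_iso (P i) f A ∘ pr i X (pf_map G f A)).
{ intros X Y f A; apply wide_pullback_unique with (2 := HF X Y f A).
  apply (wide_pullback_iso (iQ := niso_at (pn_iso Q f) A)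
    (iP := fun i => niso_at (pn_iso (P i) f) A) (iL := id_iso _))
    with (4 := H X (pf_map G f A)); cbn; intros; rewrite ?comp_id_r; auto.
  apply md_law. }
set (a X Y (f : Hom X Y) A := proj1_sig (constructive_indefinite_description _ (K X Y f A))).
assert (ab : forall X Y (f : Hom X Y) A,
  fmap (pf_map F f) (b Y A) ∘ iso_fwd (a X Y f A) = pn_iso Q f A ∘ b X (pf_map G f A)).
{ intros; apply (proj2_sig (constructive_indefinite_description _ (K X Y f A))). }
assert (apr : forall i X Y (f : Hom X Y) A,
  fmap (pf_map F f) (pr i Y A) ∘ iso_fwd (a X Y f A)
    = pn_iso (P i) f A ∘ pr i X (pf_map G f A)).
{ intros; apply (proj2_sig (constructive_indefinite_description _ (K X Y f A))). }
clearbody a; clear K.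
assert (an : forall X Y (f : Hom X Y) A B (h : Hom A B),
  iso_fwd (a X Y f B) ∘ fmap (L X) (fmap (pf_map G f) h)
  = fmap (pf_map F f) (fmap (L Y) h) ∘ iso_fwd (a X Y f A)).
(* Stated for an arbitrary target [S], so that it serves both for the base map, with [S] equal to
   [Q], and for the projections, with [S] equal to [P i]. *)
{ assert (J : forall (S : Pseudonat G F) (m : forall X, NatTrans (L X) (S X)),
    (forall X Y (f : Hom X Y) A, fmap (pf_map F f) (m Y A) ∘ iso_fwd (a X Y f A)
      = pn_iso S f A ∘ m X (pf_map G f A)) ->
    forall X Y (f : Hom X Y) A B (h : Hom A B),
      fmap (pf_map F f) (m Y B) ∘
        (iso_fwd (a X Y f B) ∘ fmap (L X) (fmap (pf_map G f) h))
      = fmap (pf_map F f) (m Y B) ∘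
        (fmap (pf_map F f) (fmap (L Y) h) ∘ iso_fwd (a X Y f A))).
  { intros S m am X Y f A B h; cbn in am |- *.
    rewrite !comp_assoc, <- fmap_comp, nt_nat, am, fmap_comp, <- !comp_assoc, am, nt_nat.
    rewrite !comp_assoc; f_equal; apply (nt_nat (pn_iso S f)). }
  intros X Y f A B h; apply (wide_pullback_mono (HF X Y f B)); intros; apply J; auto. }
set (Lf X Y f := nat_iso_of (F := L X ∘F pf_map G f) (G := pf_map F f ∘F L Y) (an X Y f)).
exists Lf; split; [split | split; [exact ab | exact apr]].
- intros X A e; cbn.
  assert (J : forall (S : Pseudonat G F) (m : forall X, NatTrans (L X) (S X)),
    fmap (pf_map F (idc X)) (m X A) ∘ eq_hom e
    = pn_iso S (idc X) A ∘ m X (pf_map G (idc X) A)).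
  { intros S m.
    assert (e' : S X (pf_map G (idc X) A) = pf_map F (idc X) (S X A)).
    { now rewrite (pf_id G X), (pf_id F X). }
    rewrite (psn_id (pn_law S) e'); apply nt_eq_hom; apply pf_id. }
  apply (wide_pullback_mono (HF X X (idc X) A)); intros; rewrite J; [apply ab | apply apr].
- intros X Y Z f g A; cbn.
  assert (J : forall (S : Pseudonat G F) (m : forall X, NatTrans (L X) (S X)),
    (forall X Y (f : Hom X Y) A, fmap (pf_map F f) (m Y A) ∘ iso_fwd (a X Y f A)
      = pn_iso S f A ∘ m X (pf_map G f A)) ->
    fmap (pf_map F (g ∘ f)) (m Z A) ∘
      (iso_fwd (a X Z (g ∘ f) A) ∘ fmap (L X) (pf_comp G f g A))
    = fmap (pf_map F (g ∘ f)) (m Z A) ∘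
      (pf_comp F f g (L Z A) ∘ fmap (pf_map F f) (iso_fwd (a Y Z g A))
        ∘ iso_fwd (a X Y f (pf_map G g A)))).
  { intros S m am; cbn in am |- *.
    rewrite !comp_assoc, am.
    rewrite <- (comp_assoc (pn_iso S (g ∘ f) A)); cbn; rewrite nt_nat, comp_assoc.
    cbn_rewrite (psn_comp (pn_law S) f g A).
    pose proof (nt_nat (pf_comp F f g) (m Z A)) as hn; cbn in hn; rewrite <- hn; clear hn; cbn.
    rewrite <- (comp_assoc _ _ (fmap (pf_map F f) (iso_fwd _))), <- fmap_comp, am, fmap_comp.
    rewrite <- !comp_assoc, am; reflexivity. }
  apply (wide_pullback_mono (HF X Z (g ∘ f) A)); intros; apply J; auto.
Qed.

(** The relation [R] records any further property of the chosen cones. *)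
Lemma pseudonatural_wide_pullback
    (R : forall X (A : G X) (L : F X), Hom L (Q X A) -> (forall i, Hom L (P i X A)) -> Prop) :
  (forall X A, exists L b pr, R X A L b pr) ->
  (forall X A L b pr, R X A L b pr -> IsWidePullback (fun i => p i X A) b pr) ->
  (forall (X Y : C) (f : Hom X Y) (A : G Y) L b pr, R Y A L b pr ->
    IsWidePullback (fun i => fmap (pf_map F f) (p i Y A)) (fmap (pf_map F f) b)
      (fun i => fmap (pf_map F f) (pr i))) ->
  exists (L : Pseudonat G F) (b : Modification L Q) (pr : forall i, Modification L (P i)),
    forall X A, R X A (L X A) (b X A) (fun i => pr i X A).
Proof.
intros K H HF.
set (L X A := proj1_sig (constructive_indefinite_description _ (K X A))).
assert (K1 : forall X A, exists b pr, R X A (L X A) b pr).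
{ intros X A; apply (proj2_sig (constructive_indefinite_description _ (K X A))). }
clearbody L; clear K.
set (b X A := proj1_sig (constructive_indefinite_description _ (K1 X A))).
assert (K2 : forall X A, exists pr, R X A (L X A) (b X A) pr).
{ intros X A; apply (proj2_sig (constructive_indefinite_description _ (K1 X A))). }
clearbody b; clear K1.
set (pr i X A := proj1_sig (constructive_indefinite_description _ (K2 X A)) i).
assert (r : forall X A, R X A (L X A) (b X A) (fun i => pr i X A)).
{ intros X A; apply (proj2_sig (constructive_indefinite_description _ (K2 X A))). }
clearbody pr; clear K2.
assert (HL : forall X A, IsWidePullback (fun i => p i X A) (b X A) (fun i => pr i X A)).
{ intros; now apply H. }
(* The chosen objects receive their action on morphisms from the universal property at the
   target. *)
assert (K : forall X (A B : G X) (h : Hom A B), exists u : Hom (L X A) (L X B),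
  b X B ∘ u = fmap (Q X) h ∘ b X A /\
  forall i, pr i X B ∘ u = fmap (P i X) h ∘ pr i X A).
{ intros X A B h; destruct (proj2 (HL X B) (L X A) (fmap (Q X) h ∘ b X A)
    (fun i => fmap (P i X) h ∘ pr i X A)) as [u [hu _]]; [| now exists u].
  intros i; rewrite comp_assoc, nt_nat, <- comp_assoc; f_equal; apply (HL X A). }
set (m X A B h := proj1_sig (constructive_indefinite_description _ (K X A B h))).
assert (mb : forall X A B h, b X B ∘ m X A B h = fmap (Q X) h ∘ b X A).
{ intros; apply (proj2_sig (constructive_indefinite_description _ (K X A B h))). }
assert (mpr : forall i X A B h, pr i X B ∘ m X A B h = fmap (P i X) h ∘ pr i X A).
{ intros; apply (proj2_sig (constructive_indefinite_description _ (K X A B h))). }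
clearbody m; clear K.
assert (m1 : forall X A, m X A A (idc A) = idc (L X A)).
{ intros X A; apply (wide_pullback_mono (HL X A)); intros; rewrite ?mb, ?mpr;
    now rewrite fmap_id, comp_id_l, comp_id_r. }
assert (m2 : forall X A B B' (h : Hom B B') (k : Hom A B),
  m X A B' (h ∘ k) = m X B B' h ∘ m X A B k).
{ intros X A B B' h k; apply (wide_pullback_mono (HL X B')); intros; rewrite comp_assoc.
  - now rewrite !mb, fmap_comp, <- !comp_assoc, mb.
  - now rewrite !mpr, fmap_comp, <- !comp_assoc, mpr. }
pose (LF X := {| fob := L X; fmap := m X; fmap_id := m1 X; fmap_comp := m2 X |}
  : Functor (G X) (F X)).
pose (bF X := Build_NatTrans (F := LF X) (G := Q X) (mb X)).
pose (prF i X := Build_NatTrans (F := LF X) (G := P i X) (mpr i X)).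
destruct (@pseudonatural_cone_functor LF bF prF) as [Lf [Ll [eb epr]]].
- exact HL.
- intros; apply HF, r.
- pose (S := Build_Pseudonat Ll).
  exists S, (Build_Modification (S := S) (T := Q) eb),
    (fun i => Build_Modification (S := S) (T := P i) (epr i)).
  exact r.
Qed.

End Modifications.
End Fibrewise.

(** * Representables *)

(** Makes the hom-sets of the representable presheaf into categories; parallel morphisms are equal
    by proof irrelevance, which settles every coherence law in [representable]. *)
Program Definition discrete (X : Type) : Category :=
  {| Ob := X; Hom := fun x y => x = y; idc := fun x => eq_refl;
     comp := fun x y z e e' => eq_trans e' e |}.
Solve All Obligations with intros; apply proof_irrelevance.

Lemma discrete_hom_eq (X : Type) (x y : discrete X) (e e' : Hom x y) : e = e'.
Proof. exact (proof_irrelevance (x = y :> X) e e'). Qed.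

Program Definition discrete_fun (X Y : Type) (h : X -> Y) : Functor (discrete X) (discrete Y) :=
  {| fob := h : discrete X -> discrete Y; fmap := fun x y e => f_equal h e |}.
Solve All Obligations with intros; apply discrete_hom_eq.

Program Definition discrete_iso (D : Category) (Y : Type) (H K : Functor D (discrete Y))
    (e : forall A, H A = K A :> Y) : NatIso H K :=
  {| niso := {| nt := e |}; niso_inv := {| nt := fun A => eq_sym (e A) |} |}.
Solve All Obligations with intros; apply discrete_hom_eq.

Lemma discrete_functor_eq (D : Category) (Y : Type) (H K : Functor D (discrete Y)) :
  (forall A, H A = K A) -> H = K.
Proof.
destruct H as [h hm i c], K as [k km i' c']; cbn; intros e.
assert (e' : h = k) by now apply functional_extensionality_dep.
subst k.
assert (e' : hm = km).
{ apply functional_extensionality_dep; intros A; apply functional_extensionality_dep; intros B.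
  apply functional_extensionality_dep; intros f; apply discrete_hom_eq. }
subst km; apply functor_eq.
Qed.

Lemma eq_hom_inverse (D : Category) (A B : D) (e : A = B) (e' : B = A) (h : Hom B A) :
  h ∘ eq_hom e = idc A -> h = eq_hom e'.
Proof.
destruct e; intros eh; rewrite (eq_hom_refl e'), <- eh; symmetry; apply comp_id_r.
Qed.

Section Yoneda.
Variables (C : Category) (X : C).

Program Definition representable : Pseudofunctor C :=
  {| pf_fib := fun W => discrete (Hom W X);
     pf_map := fun W V f => discrete_fun (fun g => g ∘ f);
     pf_comp := fun W V U f g => discrete_iso (H := discrete_fun (fun h => h ∘ f) ∘F discrete_fun (fun h : Hom U X => h ∘ g))
       (K := discrete_fun (fun h => h ∘ (g ∘ f))) (fun h => eq_sym (comp_assoc (h : Hom U X) g f)) |}.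
Next Obligation. apply discrete_functor_eq; intros; apply comp_id_r. Qed.
Next Obligation. apply discrete_hom_eq. Qed.
Next Obligation. apply discrete_hom_eq. Qed.
Next Obligation. apply discrete_hom_eq. Qed.

Variable G : Pseudofunctor C.

Program Definition name_fun (A : G X) (W : C) : Functor (representable W) (G W) :=
  {| fob := fun g : Hom W X => pf_map G g A;
     fmap := fun g h e => eq_hom (f_equal (fun k => pf_map G k A) e) |}.
Next Obligation. symmetry; apply eq_hom_comp. Qed.

Program Definition name_iso (A : G X) (W V : C) (f : Hom W V) :
    NatIso (name_fun A W ∘F pf_map representable f) (pf_map G f ∘F name_fun A V) :=
  {| niso := {| nt := fun g : Hom V X => niso_inv (pf_comp G f g) A |};
     niso_inv := {| nt := fun g : Hom V X => pf_comp G f g A |};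
     niso_inv_l := fun g => niso_inv_r (pf_comp G f g) A;
     niso_inv_r := fun g => niso_inv_l (pf_comp G f g) A |}.
Next Obligation. cbn; now rewrite fmap_id, comp_id_l, comp_id_r. Qed.
Next Obligation. cbn; now rewrite fmap_id, comp_id_l, comp_id_r. Qed.

(** The 1-cell [representable -> G] corresponding to [A] under the Yoneda lemma. *)
Program Definition name (A : G X) : Pseudonat representable G :=
  {| pn_fun := name_fun A; pn_iso := name_iso A |}.
Next Obligation.
split.
- intros W g e; cbn in e |- *.
  apply (eq_hom_inverse (e := eq_sym e)).
  rewrite <- (pf_comp_id_l (eq_sym e)); exact (niso_inv_l (pf_comp G (idc W) g) A).
- intros W V U f g h; cbn.
  set (e := f_equal _ _).
  (* The cells of [name_iso] are inverse comparison cells of [G], so the composition law is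
     [pf_assoc] inverted. Composing with the invertible cell at [g ∘ f] and [h] lets the inverses
     cancel. *)
  pose proof (pf_assoc e) as ha; cbn in ha.
  apply (iso_mono (a := niso_at (pf_comp G (g ∘ f) h) A)); cbn in *.
  rewrite (comp_assoc _ _ (eq_hom e)); cbn_rewrite (niso_inv_r (pf_comp G (g ∘ f) h) A).
  rewrite !(comp_assoc (pf_comp G (g ∘ f) h A)); cbn.
  rewrite ha, comp_id_l.
  rewrite <- (comp_assoc _ (fmap _ _) (fmap _ _)), <- fmap_comp.
  cbn_rewrite (niso_inv_r (pf_comp G g h) A).
  rewrite fmap_id, comp_id_r, <- comp_assoc.
  cbn_rewrite (niso_inv_r (pf_comp G f (h ∘ g)) A).
  now rewrite comp_id_r.
Qed.
End Yoneda.

(** * Evaluation of named 1-cells at the identity *)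

Lemma eq_hom_conj (D : Category) (K : Functor D D) (A B : D) (f : Hom A B) (e : A = K A)
    (e' : K B = B) :
  K = Fid D -> eq_hom e' ∘ fmap K f ∘ eq_hom e = f.
Proof.
intros ->; cbn in *; now rewrite !eq_hom_refl, comp_id_l, comp_id_r.
Qed.

(** The shape of the composition law of a pseudonatural transformation, rearranged so that every
    cell but the last one, [r], appears inverted. *)
Lemma mate (D : Category) (A B Z U V : D) (s : Iso B Z) (t : Iso A B) (c : Iso U Z)
    (m : Iso V U) (r : Hom A V) :
  iso_fwd s ∘ iso_fwd t = iso_fwd c ∘ iso_fwd m ∘ r ->
  iso_bwd m ∘ iso_bwd c = r ∘ iso_bwd t ∘ iso_bwd s.
Proof.
intros e; apply (iso_epi (a := s)), (iso_epi (a := t)).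
rewrite <- !comp_assoc, (comp_assoc (iso_bwd s)), iso_bf, comp_id_l, iso_bf, comp_id_r, e.
rewrite !comp_assoc, <- (comp_assoc _ (iso_bwd c)), iso_bf, comp_id_r, iso_bf.
apply comp_id_l.
Qed.

Lemma nt_transport (D E : Category) (S T : Functor D E) (a : NatTrans S T) (A B : D)
    (e : S A = S B) (e' : T A = T B) :
  A = B -> eq_hom e' ∘ a A = a B ∘ eq_hom e.
Proof. intros ->; now rewrite !eq_hom_refl, comp_id_l, comp_id_r. Qed.

Section Evaluation.
Variables (C : Category) (X : C) (G F : Pseudofunctor C) (A : G X) (Z : F X).

(** The modification corresponding to [z] under Yoneda: at [g], reindex [z] along [g] and return
    through the inverse comparison cell of [S]. *)
Program Definition name_hom (S : Pseudonat G F) (z : Hom Z (S X A)) :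
    Modification (name Z) (pn_comp S (name A)) :=
  {| md := fun W => {| nt := fun g : Hom W X =>
       niso_inv (pn_iso S g) A ∘ fmap (pf_map F g) z |} |}.
Next Obligation. cbn; now rewrite fmap_id, comp_id_l, comp_id_r. Qed.
Next Obligation.
change (Hom Y X) in A0; rename A0 into g, X0 into W, Y into V.
rewrite fmap_comp, <- comp_assoc.
cbn_rewrite (eq_sym (nt_nat (niso_inv (pf_comp F f g)) z)).
rewrite (comp_assoc (fmap _ _)), (comp_assoc _ _ (fmap _ z)); f_equal.
apply (mate (s := niso_at (pn_iso S (g ∘ f)) A)
  (t := fmap_iso (S W) (niso_at (pf_comp G f g) A))
  (c := niso_at (pf_comp F f g) (S X A))
  (m := fmap_iso (pf_map F f) (niso_at (pn_iso S g) A))).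
exact (psn_comp (pn_law S) f g A).
Qed.

Hypotheses (eZ : Z = pf_map F (idc X) Z) (eS : forall S : Pseudonat G F, S X (pf_map G (idc X) A) = S X A).

(** The opposite direction of the Yoneda correspondence. The transports [eZ] and [eS] come from
    normalization, which identifies reindexing along [idc X] with the identity only
    propositionally. *)
Definition name_eval (S : Pseudonat G F) (u : Modification (name Z) (pn_comp S (name A))) :
    Hom Z (S X A) :=
  eq_hom (eS S) ∘ u X (idc X) ∘ eq_hom eZ.

Lemma name_eval_hom (S : Pseudonat G F) (z : Hom Z (S X A)) :
  name_eval (name_hom z) = z.
Proof.
unfold name_eval; cbn.
assert (e : S X (pf_map G (idc X) A) = pf_map F (idc X) (S X A)).
{ now rewrite (pf_id G X), (pf_id F X). }
assert (e' : pf_map F (idc X) (S X A) = S X A) by now rewrite (pf_id F X).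
rewrite (eq_hom_inverse (e := e) (eq_sym e) (h := niso_inv (pn_iso S (idc X)) A)).
- rewrite comp_assoc, (eq_hom_comp (eS S) (eq_sym e) e').
  apply eq_hom_conj, pf_id.
- rewrite <- (psn_id (pn_law S) e); apply (niso_inv_l (pn_iso S (idc X))).
Qed.

Lemma name_hom_natural (S S' : Pseudonat G F) (a : Modification S S') (z : Hom Z (S X A)) :
  md_comp (md_wr a (name A)) (name_hom z) = name_hom (a X A ∘ z).
Proof.
apply modification_eq; intros W g; cbn.
apply (iso_mono (a := niso_at (pn_iso S' g) A)); cbn.
rewrite !comp_assoc; cbn_rewrite (niso_inv_r (pn_iso S' g) A).
cbn_rewrite (eq_sym (md_law a g A)).
rewrite fmap_comp, comp_id_l, <- (comp_assoc _ (pn_iso S g A)); cbn.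
cbn_rewrite (niso_inv_r (pn_iso S g) A); now rewrite comp_id_r.
Qed.

Lemma name_eval_natural (S S' : Pseudonat G F) (a : Modification S S')
    (u : Modification (name Z) (pn_comp S (name A))) :
  name_eval (md_comp (md_wr a (name A)) u) = a X A ∘ name_eval u.
Proof.
unfold name_eval; cbn; rewrite !comp_assoc; do 2 f_equal.
apply nt_transport; now rewrite (pf_id G X).
Qed.
End Evaluation.

(** Evaluation at the identity makes [F X] a retract, naturally in the 1-cell
    [S], of the hom-categories out of the representable. *)
Lemma wide_pullback_of_name (C : Category) (X : C) (G F : Pseudofunctor C) (A : G X)
    (I : Type) (Q : Pseudonat G F) (P : I -> Pseudonat G F)
    (p : forall i, Modification (P i) Q) (L : Pseudonat G F) (b : Modification L Q)
    (pr : forall i, Modification L (P i)) :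
  IsWidePullback (D := pseudonat_cat (representable X) F) (fun i => md_wr (p i) (name A))
    (md_wr b (name A)) (fun i => md_wr (pr i) (name A)) ->
  IsWidePullback (fun i => p i X A) (b X A) (fun i => pr i X A).
Proof.
intros [e H]; split.
- intros i; pose proof (f_equal (fun m : Modification (pn_comp L (name A)) (pn_comp Q (name A)) =>
      m X (idc X)) (e i)) as ei.
  cbn in ei; now rewrite (pf_id G X) in ei.
- intros Z z zs ez.
  assert (eZ : Z = pf_map F (idc X) Z) by now rewrite (pf_id F X).
  assert (eS : forall S : Pseudonat G F, S X (pf_map G (idc X) A) = S X A).
  { intros S; now rewrite (pf_id G X). }
  destruct (H (name Z) (name_hom z) (fun i => name_hom (zs i))) as [u [[u1 u2] hu]].
  { intros i; rewrite <- (ez i); apply name_hom_natural. }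
  exists (name_eval eZ eS u); split; [split |].
  + rewrite <- name_eval_natural, <- (name_eval_hom eZ eS z); f_equal; exact u1.
  + intros i; rewrite <- name_eval_natural, <- (name_eval_hom eZ eS (zs i)); f_equal.
    exact (u2 i).
  + intros v [v1 v2].
    (* Any competitor [v] gives a mediating map [name_hom v] of the named cones, hence equals [u]
       before evaluation. *)
    rewrite <- (name_eval_hom eZ eS v); f_equal; apply hu; split.
    * rewrite <- v1; apply name_hom_natural.
    * intros i; rewrite <- v2; apply name_hom_natural.
Qed.

(** * Pointwise limits in the 2-category of pseudofunctors *)

Lemma fmap_pullback_wide (D E : Category) (F : Functor D E) (A B Q L : D) (f : Hom A Q)
    (g : Hom B Q) (l1 : Hom L A) (l2 : Hom L B) :
  IsPullback (fmap F f) (fmap F g) (fmap F l1) (fmap F l2) <->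
  IsWidePullback (fun i => fmap F (bool_into f g i)) (fmap F (f ∘ l1))
    (fun i => fmap F (bool_from l1 l2 i)).
Proof.
rewrite (pullback_wide (fmap F g) (fmap F l2) (eq_sym (fmap_comp F f l1))).
symmetry; apply fmap_bool_wide.
Qed.

Lemma pullback_ext (D : Category) (A B Q L : D) (f f' : Hom A Q) (g g' : Hom B Q)
    (l1 l1' : Hom L A) (l2 l2' : Hom L B) :
  f = f' -> g = g' -> l1 = l1' -> l2 = l2' ->
  IsPullback f g l1 l2 -> IsPullback f' g' l1' l2'.
Proof. now intros -> -> -> ->. Qed.

Section Pointwise.
Variable C : Category.

(** Taking components as a functor makes the general lemmas on preservation of limits applicable to
    it. *)
Program Definition evaluation (G F : Pseudofunctor C) (X : C) (A : G X) :
    Functor (pseudonat_cat G F) (F X) :=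
  {| fob := fun S : Pseudonat G F => S X A; fmap := fun S S' a => md a X A |}.

(** From left to right, the pointwise clause is used at the 1-cell [name A]. Conversely,
    precomposition with [h] only replaces the object [A] by [h X A], so the fibrewise condition is
    stable under it. *)
Lemma pointwise_power_fibrewise (G F : Pseudofunctor C) (P Q L : Pseudonat G F)
    (p : Modification P Q) (n : nat) (b : Modification L Q)
    (pr : Fin.t n -> Modification L P) :
  IsPointwisePullbackPower (K := Bicat C) (X := G) (Y := F) p b pr <->
  forall X A, IsPullbackPower (p X A) (b X A) (fun i => pr i X A).
Proof.
split.
- intros [_ H] X A.
  apply (wide_pullback_of_name (p := fun _ => p)); exact (H (representable X) (name A)).
- intros H; split.
  + exact (fibrewise_wide_pullback (p := fun _ => p) H).
  + intros G' h.
    apply (fibrewise_wide_pullback (p := fun _ => md_wr p h) (pr := fun i => md_wr (pr i) h)).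
    intros X A; exact (H X (h X A)).
Qed.

Lemma fibrewise_pullback (G F : Pseudofunctor C) (P P' Q L : Pseudonat G F)
    (f : Modification P Q) (g : Modification P' Q) (l1 : Modification L P)
    (l2 : Modification L P') :
  (forall X A, IsPullback (f X A) (g X A) (l1 X A) (l2 X A)) ->
  IsPullback (D := pseudonat_cat G F) f g l1 l2.
Proof.
intros H.
apply (pullback_wide (D := pseudonat_cat G F) _ _ eq_refl).
apply (@fibrewise_wide_pullback C G F bool Q (bool_fam (D := pseudonat_cat G F) P P')
  (bool_into (D := pseudonat_cat G F) f g) L (md_comp f l1)
  (bool_from (D := pseudonat_cat G F) l1 l2)).
intros X A; apply (fmap_pullback_wide (evaluation F A) f g l1 l2), H.
Qed.

Lemma pointwise_pullback_fibrewise (G F : Pseudofunctor C) (P P' Q L : Pseudonat G F)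
    (f : Modification P Q) (g : Modification P' Q) (l1 : Modification L P)
    (l2 : Modification L P') :
  IsPointwisePullback (K := Bicat C) (X := G) (Y := F) f g l1 l2 <->
  forall X A, IsPullback (f X A) (g X A) (l1 X A) (l2 X A).
Proof.
split.
- intros [_ H] X A.
  apply (fmap_pullback_wide (evaluation F A) f g l1 l2).
  apply (@wide_pullback_of_name C X G F A bool Q (bool_fam (D := pseudonat_cat G F) P P')
    (bool_into (D := pseudonat_cat G F) f g) L _
    (bool_from (D := pseudonat_cat G F) l1 l2)).
  apply (fmap_pullback_wide (precomp (K := Bicat C) F (name A)) f g l1 l2), H.
- intros H; split; [now apply fibrewise_pullback |].
  intros G' h; apply (fibrewise_pullback (f := md_wr f h) (g := md_wr g h)
    (l1 := md_wr l1 h) (l2 := md_wr l2 h)).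
  intros X A; exact (H X (h X A)).
Qed.

(** Lets preservation by powers of postcomposition with [T] be read off in the fibres. The object
    and morphism parts agree by conversion once the recursion on [m] is unfolded. *)
Lemma evaluation_iter (F : Pseudofunctor C) (T : Pseudonat F F) (X : C) (A : F X) (m : nat) :
  evaluation F A ∘F Fiter (postcomp (K := Bicat C) F T) m
  = Fiter (T X) m ∘F evaluation F A.
Proof.
induction m as [| m IH]; [apply functor_eq |].
transitivity (T X ∘F (evaluation F A ∘F Fiter (postcomp (K := Bicat C) F T) m));
  [apply functor_eq |].
rewrite IH; apply functor_eq.
Qed.

Lemma pointwise_power_iter (F : Pseudofunctor C) (T P Q L : Pseudonat F F)
    (p : Modification P Q) (n : nat) (b : Modification L Q)
    (pr : Fin.t n -> Modification L P) (m : nat) :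
  IsPointwisePullbackPower (K := Bicat C) (X := F) (Y := F)
    (fmap (Fiter (postcomp (K := Bicat C) F T) m) p)
    (fmap (Fiter (postcomp (K := Bicat C) F T) m) b)
    (fun i => fmap (Fiter (postcomp (K := Bicat C) F T) m) (pr i)) <->
  forall X A, IsPullbackPower (fmap (Fiter (T X) m) (p X A)) (fmap (Fiter (T X) m) (b X A))
    (fun i => fmap (Fiter (T X) m) (pr i X A)).
Proof.
rewrite pointwise_power_fibrewise.
assert (K : forall X (A : F X) (H H' : Functor (pseudonat_cat F F) (F X)), H = H' ->
  IsPullbackPower (fmap H p) (fmap H b) (fun i => fmap H (pr i)) <->
  IsPullbackPower (fmap H' p) (fmap H' b) (fun i => fmap H' (pr i))).
{ now intros X A H H' ->. }
split; intros h X A; apply (K X A _ _ (evaluation_iter T A m)); exact (h X A).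
Qed.

Section Cells.
Variables (F : Pseudofunctor C) (t : TangentTuple (K := Bicat C) F).

(** The strict unit and associativity corrections compare 1-cells whose values on objects are
    convertible, so all their components are identities. *)
Ltac cell := cbn; repeat match goal with |- context [nt (md (eq_hom ?e) ?X) ?A] =>
  rewrite (@md_eq_hom _ _ _ _ _ e X A eq_refl); cbn end; now rewrite ?comp_id_l, ?comp_id_r.

Lemma T_p_cell X A : md (T_p t) X A = fmap (pn_fun (oT t) X) (md (op t) X A).
Proof. cell. Qed.

Lemma p_T_cell X A : md (p_T t) X A = md (op t) X (pn_fun (oT t) X A).
Proof. cell. Qed.

Lemma T_zero_cell X A : md (T_zero t) X A = fmap (pn_fun (oT t) X) (md (ozero t) X A).
Proof. cell. Qed.

Lemma zero_T_cell X A : md (zero_T t) X A = md (ozero t) X (pn_fun (oT t) X A).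
Proof. cell. Qed.

Lemma lift_T_cell X A : md (lift_T t) X A = md (olift t) X (pn_fun (oT t) X A).
Proof. cell. Qed.

Lemma flip_T_cell X A : md (flip_T t) X A = md (oflip t) X (pn_fun (oT t) X A).
Proof. cell. Qed.
End Cells.
End Pointwise.

(** * Tangent objects and tangent indexing functors *)

Section Tangent_category.
Variables (D : Category) (t : TangentData D).

(** Naturality gives p p_T = p T(p). Then T(p) sends the sum to its first summand ℓ π1, the law for
    T(p) ℓ yields 0 p π1, and p 0 is the identity. This supplies the second leg required by
    [pullback_equalizer]. *)
Lemma lifted_pair_base (A : D) (u : Hom (tT2 t A) (tT t (tT2 t A))) :
  IsCommMonoidOver (tp t A) (tpi1 t A) (tpi2 t A) (tzero t A) (tadd t A) ->
  fmap (tT t) (tp t A) ∘ tlift t A = tzero t A ∘ tp t A ->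
  fmap (tT t) (tpi1 t A) ∘ u = tlift t A ∘ tpi1 t A ->
  tp t A ∘ tp t (tT t A) ∘ (fmap (tT t) (tadd t A) ∘ u) = tp t A ∘ tpi1 t A.
Proof.
intros M el eu.
assert (ep : tp t A ∘ tp t (tT t A) = tp t A ∘ fmap (tT t) (tp t A)).
{ symmetry; apply (nt_nat (tp t)). }
pose proof (cm_add_over M) as ea; pose proof (cm_zero_over M) as ez.
cbn in *; rewrite ep, <- !comp_assoc, (comp_assoc (fmap _ _)), <- fmap_comp, ea.
rewrite fmap_comp, <- (comp_assoc (fmap _ _)), eu, (comp_assoc (fmap _ _)), el.
rewrite <- !comp_assoc, (comp_assoc (tp t A)); cbn; rewrite ez; apply comp_id_l.
Qed.

Lemma universal_pullback_equalizer (A : D) (u : Hom (tT2 t A) (tT t (tT2 t A))) :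
  IsCommMonoidOver (tp t A) (tpi1 t A) (tpi2 t A) (tzero t A) (tadd t A) ->
  fmap (tT t) (tp t A) ∘ tlift t A = tzero t A ∘ tp t A ->
  fmap (tT t) (tpi1 t A) ∘ u = tlift t A ∘ tpi1 t A ->
  IsPullback (fmap (tT t) (tp t A)) (tzero t A) (fmap (tT t) (tadd t A) ∘ u)
    (tp t A ∘ tpi1 t A) <->
  IsEqualizer (fmap (tT t) (tp t A)) (tzero t A ∘ tp t A ∘ tp t (tT t A))
    (fmap (tT t) (tadd t A) ∘ u).
Proof.
intros M el eu; rewrite <- comp_assoc; apply pullback_equalizer with (p := tp t A).
- apply M.
- apply (nt_nat (tp t)).
- now apply lifted_pair_base.
Qed.

Lemma tangent_pullback_preserved (A : D) : IsTangentStructure t ->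
  IsPullback (fmap (tT t) (tp t A)) (fmap (tT t) (tp t A)) (fmap (tT t) (tpi1 t A))
    (fmap (tT t) (tpi2 t A)).
Proof.
intros H.
pose proof (cm_product (ts_monoid H A)) as M.
rewrite (pullback_power2 _ (eq_refl (tp t A ∘ tpi1 t A))) in M.
destruct (ts_powers H A 2) as [L [b [pr [P PT]]]].
(* The iterate with [m] equal to 1 is [tT t ∘F Fid D], which acts as [tT t] by conversion. *)
pose proof (preserves_any_wide_pullback P M (PT 1)) as K.
apply (pullback_power2 _ (eq_sym (fmap_comp (tT t) (tp t A) (tpi1 t A)))).
apply (wide_pullback_ext) with (4 := K); try reflexivity.
intros i; pattern i; apply fin2_rect; reflexivity.
Qed.
(** This and the next two lemmas are the fibrewise conditions under which the pairings of the
    tangent axioms can be formed as 2-cells. *)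
Lemma lift_pair_compatible (A : D) : IsTangentStructure t ->
  fmap (tT t) (tp t A) ∘ (tlift t A ∘ tpi1 t A)
  = fmap (tT t) (tp t A) ∘ (tlift t A ∘ tpi2 t A).
Proof.
intros H; pose proof (ts_lift_p H A) as e; cbn in e |- *.
rewrite !comp_assoc, e, <- !comp_assoc; f_equal; apply (ts_monoid H A).
Qed.

Lemma lift_zero_pair_compatible (A : D) : IsTangentStructure t ->
  fmap (tT t) (tp t A) ∘ (tlift t A ∘ tpi1 t A)
  = fmap (tT t) (tp t A) ∘ (tzero t (tT t A) ∘ tpi2 t A).
Proof.
intros H; pose proof (ts_lift_p H A) as e; pose proof (nt_nat (tzero t) (tp t A)) as e'.
cbn in e, e' |- *.
rewrite !comp_assoc, e, <- e', <- !comp_assoc; f_equal; apply (ts_monoid H A).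
Qed.

Lemma flip_pair_compatible (A : D) : IsTangentStructure t ->
  tp t (tT t A) ∘ (tflip t A ∘ fmap (tT t) (tpi1 t A))
  = tp t (tT t A) ∘ (tflip t A ∘ fmap (tT t) (tpi2 t A)).
Proof.
intros H; pose proof (ts_flip_p H A) as e; cbn in e |- *.
rewrite !comp_assoc, e; exact (proj1 (tangent_pullback_preserved A H)).
Qed.
End Tangent_category.

Lemma iso_square (D : Category) (A A' B B' : D) (s : Iso A B) (r : Iso A' B') (m : Hom B B')
    (m' : Hom A A') :
  m ∘ iso_fwd s = iso_fwd r ∘ m' <-> m' ∘ iso_bwd s = iso_bwd r ∘ m.
Proof.
split; intros e.
- apply (iso_epi (a := s)); rewrite <- !comp_assoc, e, iso_bf, comp_id_r.
  now rewrite comp_assoc, iso_bf, comp_id_l.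
- apply (iso_mono (a := {| iso_fwd := iso_bwd r; iso_bwd := iso_fwd r;
    iso_fb := iso_bf r; iso_bf := iso_fb r |})); cbn.
  now rewrite comp_assoc, <- e, <- comp_assoc, iso_bf, comp_id_r, comp_assoc, iso_bf, comp_id_l.
Qed.

(** * From tangent objects to tangent indexing functors *)

Section Fibres.
Variables (C : Category) (F : Pseudofunctor C).

(** The cells of a tangent morphism point opposite to the pseudonaturality cells; in inverted form
    the modification law reads as a tangent morphism axiom. *)
Lemma modification_square (S S' : Pseudonat F F) (m : forall X, NatTrans (S X) (S' X))
    (X Y : C) (f : Hom X Y) (A : F Y) :
  fmap (pf_map F f) (m Y A) ∘ pn_iso S f A = pn_iso S' f A ∘ m X (pf_map F f A) <->
  m X (pf_map F f A) ∘ niso_inv (pn_iso S f) A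
    = niso_inv (pn_iso S' f) A ∘ fmap (pf_map F f) (m Y A).
Proof. exact (iso_square (niso_at (pn_iso S f) A) (niso_at (pn_iso S' f) A) _ _). Qed.

Lemma fibrewise_pullback_preserved (P P' Q L : Pseudonat F F)
    (f : Modification P Q) (g : Modification P' Q) (l1 : Modification L P)
    (l2 : Modification L P') :
  (forall X A, IsPullback (f X A) (g X A) (l1 X A) (l2 X A)) ->
  forall (X Y : C) (h : Hom X Y) (A : F Y),
    IsPullback (fmap (pf_map F h) (f Y A)) (fmap (pf_map F h) (g Y A))
      (fmap (pf_map F h) (l1 Y A)) (fmap (pf_map F h) (l2 Y A)).
Proof.
intros H X Y h A.
apply (fmap_pullback_wide (pf_map F h ∘F evaluation F A) f g l1 l2).
apply (@fibrewise_preserved C F F bool Q (bool_fam (D := pseudonat_cat F F) P P')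
  (bool_into (D := pseudonat_cat F F) f g) L (md_comp f l1)
  (bool_from (D := pseudonat_cat F F) l1 l2)).
clear X Y h A; intros X A; apply (fmap_pullback_wide (evaluation F A) f g l1 l2), H.
Qed.

Lemma cell_eq (S S' : Pseudonat F F) (a b : Modification S S') :
  a = b -> forall X A, a X A = b X A.
Proof. now intros ->. Qed.

Variable t : TangentTuple (K := Bicat C) F.

Lemma comp_cell (S S' S'' : cell1 (F : Bicat C) (F : Bicat C)) (b : Hom S' S'')
    (a : Hom S S') X A : md (b ∘ a) X A = md b X A ∘ md a X A.
Proof. reflexivity. Qed.

Ltac cells e := match goal with A : Ob (pf_fib _ _) |- _ =>
  let h := fresh in pose proof (cell_eq e A) as h;
  rewrite ?comp_cell, ?T_p_cell, ?p_T_cell, ?T_zero_cell, ?zero_T_cell, ?lift_T_cell,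
    ?flip_T_cell in h; exact h end.

Local Notation fib X := (ix_tan (tuple_data t) X).

Lemma tangent_object_fibre : IsTangentObject t -> forall X, IsTangentStructure (fib X).
Proof.
intros H X.
assert (powers : forall (A : F X) n, exists (L : Pseudonat F F)
  (b : Modification L (pn_id F)) (pr : Fin.t n -> Modification L (oT t)),
  IsPullbackPower (tp (fib X) A) (b X A) (fun i => pr i X A) /\
  forall m, IsPullbackPower (fmap (Fiter (tT (fib X)) m) (tp (fib X) A))
    (fmap (Fiter (tT (fib X)) m) (b X A))
    (fun i => fmap (Fiter (tT (fib X)) m) (pr i X A))).
{ intros A n; destruct (to_powers H n) as [L [b [pr [P PT]]]].
  exists L, b, pr; split.
  - exact (proj1 (pointwise_power_fibrewise (op t) b pr) P X A).
  - intros m; exact (proj1 (pointwise_power_iter (oT t) (op t) b pr m) (PT m) X A). }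
assert (monoid : forall A : F X, IsCommMonoidOver (tp (fib X) A) (tpi1 (fib X) A)
  (tpi2 (fib X) A) (tzero (fib X) A) (tadd (fib X) A)).
{ intros A.
  destruct (to_powers H 3) as [L [b [pr [P _]]]].
  apply (comm_monoid_functor (F := evaluation F A) (to_monoid H)) with (2 := proj1 P).
  (* The monoid axiom states the pullback [T2] only in the hom-category. Its components are
     pullbacks because it is isomorphic to the pointwise 2-fold power. *)
  - destruct (to_powers H 2) as [L2 [b2 [pr2 [P2 _]]]].
    pose proof (cm_product (to_monoid H)) as M.
    rewrite (pullback_power2 _ (eq_refl (op t ∘ opi1 t))) in M.
    apply (pullback_power2 _ (eq_sym (fmap_comp (evaluation F A) (op t) (opi1 t)))).
    pose proof (proj1 (pointwise_power_fibrewise (op t) b2 pr2) P2 X A) as K2.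
    pose proof (preserves_any_wide_pullback (F := evaluation F A) (proj1 P2) M K2) as K.
    apply (wide_pullback_ext) with (4 := K); try reflexivity.
    intros i; pattern i; apply fin2_rect; reflexivity.
  - exact (proj1 (pointwise_power_fibrewise (op t) b pr) P X A). }
assert (lift_p : forall A : F X, fmap (tT (fib X)) (tp (fib X) A) ∘ tlift (fib X) A
  = tzero (fib X) A ∘ tp (fib X) A).
{ intros A; cbn; rewrite <- T_p_cell; exact (cell_eq (to_lift_p H) A). }
split; try assumption; intros A.
- intros n; destruct (powers A n) as [L [b [pr P]]].
  exact (ex_intro _ _ (ex_intro _ _ (ex_intro _ _ P))).
- destruct (to_lift_add H) as [u [u1 [u2 u3]]].
  exists (md u X A); split; [| split]; [exact (cell_eq u1 A) | exact (cell_eq u2 A) |].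
  exact (cell_eq u3 A).
- cells (to_lift_zero H).
- cells (to_flip_p H).
- destruct (to_flip_add H) as [u [u1 [u2 u3]]].
  exists (md u X A); split; [| split]; [exact (cell_eq u1 A) | exact (cell_eq u2 A) |].
  exact (cell_eq u3 A).
- cells (to_flip_zero H).
- exact (cell_eq (to_flip_flip H) A).
- exact (cell_eq (to_flip_lift H) A).
- cells (to_lift_lift H).
- cells (to_hexagon H).
- cells (to_flip_flip_lift H).
- destruct (to_universal H) as [u [u1 [u2 u3]]].
  exists (md u X A); split; [| split].
  + exact (cell_eq u1 A).
  + cells u2.
  + apply universal_pullback_equalizer; [apply monoid | apply lift_p | exact (cell_eq u1 A) |].
    cbn; rewrite <- T_p_cell.
    exact (proj1 (pointwise_pullback_fibrewise (T_p t) (ozero t) (wl (oT t) (oadd t) ∘ u)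
      (op t ∘ opi1 t)) u3 X A).
Qed.

Lemma tangent_object_strong : IsTangentObject t -> forall (X Y : C) (f : Hom X Y),
  IsStrongTangentMorphism (ix_iso (tuple_data t) f).
Proof.
intros H X Y f; split; [split; intros A | |].
- pose proof (proj1 (modification_square (op t) f A) (md_law (op t) f A)) as e.
  cbn in e |- *; now rewrite comp_id_l in e.
- pose proof (proj1 (modification_square (ozero t) f A) (md_law (ozero t) f A)) as e.
  cbn in e |- *; now rewrite comp_id_r in e.
(* The induced map on [T2] is the inverse comparison cell of the 1-cell [T2], by the modification
   laws of its projections. *)
- exists (niso_inv (pn_iso (oT2 t) f) A); split; [| split].
  + exact (proj1 (modification_square (opi1 t) f A) (md_law (opi1 t) f A)).
  + exact (proj1 (modification_square (opi2 t) f A) (md_law (opi2 t) f A)).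
  + exact (eq_sym (proj1 (modification_square (oadd t) f A) (md_law (oadd t) f A))).
- exact (proj1 (modification_square (olift t) f A) (md_law (olift t) f A)).
- exact (proj1 (modification_square (oflip t) f A) (md_law (oflip t) f A)).
- intros A n L b pr P.
  destruct (to_powers H n) as [L' [b' [pr' [P' _]]]].
  pose proof (proj1 (pointwise_power_fibrewise (op t) b' pr') P') as K.
  exact (preserves_any_wide_pullback (K Y A) P (fibrewise_preserved (p := fun _ => op t) K f A)).
- intros A L l P.
  pose proof (ts_monoid (tangent_object_fibre H Y) A) as M.
  set (d := fib Y) in *.
  assert (r : tp d A ∘ fmap (tT d) (tp d A) = tp d A ∘ tp d (tT d A)).
  { apply (nt_nat (tp d)). }
  (* The given equalizer is turned into a pullback of T(p) and 0, compared with the universal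
     pullback of the tuple, which reindexing preserves, and turned back into an equalizer. *)
  rewrite <- comp_assoc in P |- *.
  pose proof (proj2 (pullback_equalizer (cm_zero_over M) r (eq_refl (_ ∘ l))) P) as PL.
  rewrite fmap_comp.
  apply (pullback_equalizer (p := fmap (pf_map F f) (tp d A)) (w := fmap (pf_map F f) (tp d A ∘ tp d (tT d A) ∘ l))).
  + rewrite <- fmap_comp, (cm_zero_over M); apply fmap_id.
  + exact (eq_trans (eq_sym (fmap_comp _ _ _)) (f_equal (fun k => fmap (pf_map F f) k) r)).
  + symmetry; apply fmap_comp.
  + destruct (to_universal H) as [u [_ [_ U]]].
    pose proof (proj1 (pointwise_pullback_fibrewise (T_p t) (ozero t)
      (wl (oT t) (oadd t) ∘ u) (op t ∘ opi1 t)) U) as K.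
    pose proof (fibrewise_pullback_preserved K f A) as KF.
    pose proof (pullback_ext (T_p_cell t A) eq_refl eq_refl eq_refl (K Y A)) as K'.
    pose proof (pullback_ext (f_equal (fun k => fmap (pf_map F f) k) (T_p_cell t A))
      eq_refl eq_refl eq_refl KF) as KF'.
    exact (preserves_any_pullback K' PL KF').
Qed.

Lemma tangent_object_indexing : IsTangentObject t -> IsTangentIndexing (tuple_data t).
Proof.
intros H; split.
- now apply tangent_object_fibre.
- now apply tangent_object_strong.
- exact (pn_law (oT t)).
Qed.
End Fibres.

(** * From tangent indexing functors to tangent objects *)

Section Assembly.
Variables (C : Category) (F : Pseudofunctor C).

Lemma indexing_tangent_object (t : TangentTuple (K := Bicat C) F) :
  IsTangentIndexing (tuple_data t) -> IsTangentObject t.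
Proof.
intros H; pose proof (ti_fibre H) as S; pose proof (ti_strong H) as SF.
set (d X := ix_tan (tuple_data t) X) in *.
pose proof (fun X A => cm_product (ts_monoid (S X) A)) as M.
assert (P1 : IsPullback (D := pseudonat_cat F F) (op t) (op t) (opi1 t) (opi2 t)).
{ apply fibrewise_pullback; exact M. }
(* [P2] and [P3] are limits of pseudonatural transformations, so the pairings formed with them below
   are modifications. *)
assert (P2 : IsPullback (D := pseudonat_cat F F) (wl (oT t) (op t)) (wl (oT t) (op t))
  (wl (oT t) (opi1 t)) (wl (oT t) (opi2 t))).
{ apply fibrewise_pullback; intros X A; exact (tangent_pullback_preserved A (S X)). }
assert (P3 : IsPullback (D := pseudonat_cat F F) (wr (op t) (oT t)) (wr (op t) (oT t))
  (wr (opi1 t) (oT t)) (wr (opi2 t) (oT t))).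
{ apply fibrewise_pullback; intros X A; exact (M X (pn_fun (oT t) X A)). }
split.
- intros n.
  (* The relation records preservation by all iterates of the tangent functor, so the cones
     assembled into a 1-cell retain it. *)
  destruct (@pseudonatural_wide_pullback C F F (Fin.t n) (pn_id F) (fun _ => oT t)
    (fun _ => op t) (fun X A L b pr =>
      IsPullbackPower (tp (d X) A) b pr /\
      forall m, IsPullbackPower (fmap (Fiter (tT (d X)) m) (tp (d X) A))
        (fmap (Fiter (tT (d X)) m) b) (fun i => fmap (Fiter (tT (d X)) m) (pr i))))
    as [L [b [pr R]]].
  + intros X A; exact (ts_powers (S X) A n).
  + now intros X A L b pr [P _].
  + intros X Y f A L b pr [P _]; exact (stm_powers (SF X Y f) P).
  + exists L, b, pr; split; [| intros m].
    * apply (pointwise_power_fibrewise (op t) b pr); intros X A; apply (R X A).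
    * apply (pointwise_power_iter (oT t) (op t) b pr m); intros X A; apply (R X A).
- split.
  + exact P1.
  + apply modification_eq; intros X A; exact (cm_zero_over (ts_monoid (S X) A)).
  + apply modification_eq; intros X A; exact (cm_add_over (ts_monoid (S X) A)).
  + intros Z u e; apply modification_eq; intros X A.
    exact (cm_unit (ts_monoid (S X) A) (cell_eq e A)).
  + intros Z u v e1 e2; apply modification_eq; intros X A.
    exact (cm_comm (ts_monoid (S X) A) (cell_eq e1 A) (cell_eq e2 A)).
  + intros Z xy yz xy_z x_yz e1 e2 e3 e4 e5; apply modification_eq; intros X A.
    exact (cm_assoc (ts_monoid (S X) A) (cell_eq e1 A) (cell_eq e2 A) (cell_eq e3 A)
      (cell_eq e4 A) (cell_eq e5 A)).
- apply modification_eq; intros X A; rewrite comp_cell, T_p_cell; exact (ts_lift_p (S X) A).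
- destruct (pullback_pair (z1 := olift t ∘ opi1 t) (z2 := olift t ∘ opi2 t) P2)
    as [u [u1 u2]].
  { apply modification_eq; intros X A.
    exact (lift_pair_compatible A (S X)). }
  exists u; split; [exact u1 | split; [exact u2 |]].
  apply modification_eq; intros X A; destruct (ts_lift_add (S X) A) as [v [v1 [v2 v3]]].
  (* The map [v] from the fibre axiom and the component of [u] have the same projections, hence
     coincide. *)
  replace v with (md u X A) in v3; [exact v3 |].
  apply (pullback_mono (tangent_pullback_preserved A (S X))).
  + exact (eq_trans (cell_eq u1 A) (eq_sym v1)).
  + exact (eq_trans (cell_eq u2 A) (eq_sym v2)).
- apply modification_eq; intros X A; rewrite !comp_cell, T_zero_cell.
  exact (ts_lift_zero (S X) A).
- apply modification_eq; intros X A; rewrite comp_cell, p_T_cell, T_p_cell.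
  exact (ts_flip_p (S X) A).
- destruct (pullback_pair (z1 := oflip t ∘ wl (oT t) (opi1 t))
    (z2 := oflip t ∘ wl (oT t) (opi2 t)) P3) as [u [u1 u2]].
  { apply modification_eq; intros X A.
    exact (flip_pair_compatible A (S X)). }
  exists u; split; [exact u1 | split; [exact u2 |]].
  apply modification_eq; intros X A; destruct (ts_flip_add (S X) A) as [v [v1 [v2 v3]]].
  replace v with (md u X A) in v3; [exact v3 |].
  apply (pullback_mono (M X (tT (d X) A))).
  + exact (eq_trans (cell_eq u1 A) (eq_sym v1)).
  + exact (eq_trans (cell_eq u2 A) (eq_sym v2)).
- apply modification_eq; intros X A; rewrite !comp_cell, T_zero_cell, zero_T_cell.
  exact (ts_flip_zero (S X) A).
- apply modification_eq; intros X A; exact (ts_flip_flip (S X) A).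
- apply modification_eq; intros X A; exact (ts_flip_lift (S X) A).
- apply modification_eq; intros X A; rewrite !comp_cell, lift_T_cell.
  exact (ts_lift_lift (S X) A).
- apply modification_eq; intros X A; rewrite !comp_cell, flip_T_cell.
  exact (ts_hexagon (S X) A).
- apply modification_eq; intros X A; rewrite !comp_cell, flip_T_cell, lift_T_cell.
  exact (ts_flip_flip_lift (S X) A).
- destruct (pullback_pair (z1 := olift t ∘ opi1 t) (z2 := zero_T t ∘ opi2 t) P2)
    as [u [u1 u2]].
  { apply modification_eq; intros X A; rewrite !comp_cell, zero_T_cell.
    exact (lift_zero_pair_compatible A (S X)). }
  exists u; split; [exact u1 | split; [exact u2 |]].
  apply (pointwise_pullback_fibrewise (T_p t) (ozero t) (wl (oT t) (oadd t) ∘ u)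
    (op t ∘ opi1 t)).
  intros X A; apply (pullback_ext (eq_sym (T_p_cell t A)) eq_refl eq_refl eq_refl).
  pose proof (cell_eq u2 A) as e2; rewrite !comp_cell, zero_T_cell in e2.
  apply (universal_pullback_equalizer (t := d X) (ts_monoid (S X) A) (ts_lift_p (S X) A)
    (cell_eq u1 A)).
  destruct (ts_universal (S X) A) as [v [v1 [v2 v3]]].
  replace v with (md u X A) in v3; [exact v3 |].
  apply (pullback_mono (tangent_pullback_preserved A (S X))).
  + exact (eq_trans (cell_eq u1 A) (eq_sym v1)).
  + exact (eq_trans e2 (eq_sym v2)).
Qed.

Lemma pairing_at (D E : Category) (G H : Functor D E) (a b : NatTrans G H) (A : D) i :
  pairing (a A) (b A) i = pairing a b i A.
Proof. pattern i; apply fin2_rect; reflexivity. Qed.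

Lemma base_natural (D : Category) (t : TangentData D) (A B : D) (f : Hom A B) :
  tp t B ∘ tpi1 t B ∘ fmap (tT2 t) f = fmap (Fid D) f ∘ (tp t A ∘ tpi1 t A).
Proof.
pose proof (nt_nat (tp t) f) as e; cbn in e |- *.
now rewrite <- comp_assoc, nt_nat, comp_assoc, e, <- comp_assoc.
Qed.

(** The data contain no comparison cells for [T2]. They are constructed from the universal property,
    since strong morphisms preserve the 2-fold power; the other modification laws are inverted
    tangent morphism axioms. *)
Lemma indexing_tuple (d : IndexingData F) :
  IsTangentIndexing d -> exists t : TangentTuple (K := Bicat C) F, tuple_data t = d.
Proof.
intros [S SF PN].
pose (T := Build_Pseudonat PN).
pose proof (fun X Y f => stm_morphism (SF X Y f)) as TM.
pose proof (fun X A => cm_product (ts_monoid (S X) A)) as M.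
assert (lp : forall (X Y : C) (f : Hom X Y) (A : F Y),
  fmap (pf_map F f) (tp (ix_tan d Y) A) ∘ pn_iso T f A
  = pn_iso (pn_id F) f A ∘ tp (ix_tan d X) (pf_map F f A)).
{ intros X Y f A; apply (modification_square (S := T) (S' := pn_id F)
    (fun X => tp (ix_tan d X)) f A).
  cbn; rewrite comp_id_l; exact (tm_p (TM X Y f) A). }
pose (p := Build_Modification (S := T) (T := pn_id F) lp).
destruct (@pseudonatural_cone_functor C F F (Fin.t 2) (pn_id F) (fun _ => T) (fun _ => p)
  (fun X => tT2 (ix_tan d X))
  (fun X => Build_NatTrans (F := tT2 (ix_tan d X)) (G := Fid (F X))
    (nt := fun A => tp (ix_tan d X) A ∘ tpi1 (ix_tan d X) A)
    (base_natural (ix_tan d X)))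
  (fun i X => pairing (tpi1 (ix_tan d X)) (tpi2 (ix_tan d X)) i))
  as [T2f [T2l [_ pr]]].
- intros X A; pose proof (M X A) as K.
  rewrite (pullback_power2 _ (eq_refl (tp (ix_tan d X) A ∘ tpi1 (ix_tan d X) A))) in K.
  apply (wide_pullback_ext) with (4 := K); try reflexivity; intros i; apply pairing_at.
- intros X Y f A; pose proof (M Y A) as K.
  rewrite (pullback_power2 _ (eq_refl (tp (ix_tan d Y) A ∘ tpi1 (ix_tan d Y) A))) in K.
  apply (stm_powers (SF X Y f)) in K.
  apply (wide_pullback_ext) with (4 := K); try reflexivity; intros i; f_equal; apply pairing_at.
- pose (T2 := Build_Pseudonat T2l).
  pose proof (pr Fin.F1) as pr1; pose proof (pr (Fin.FS Fin.F1)) as pr2.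
  assert (la : forall (X Y : C) (f : Hom X Y) (A : F Y),
    fmap (pf_map F f) (tadd (ix_tan d Y) A) ∘ pn_iso T2 f A
    = pn_iso T f A ∘ tadd (ix_tan d X) (pf_map F f A)).
  { intros X Y f A; apply (modification_square (S := T2) (S' := T)
      (fun X => tadd (ix_tan d X)) f A).
    (* [tm_add] speaks of some induced map [a2]; its projections identify it with the inverse of the
       constructed comparison cell of [T2]. *)
    destruct (tm_add (TM X Y f) A) as [a2 [e1 [e2 e3]]].
    apply (modification_square (S := T2) (S' := T) (fun X => tpi1 (ix_tan d X)) f A) in pr1.
    apply (modification_square (S := T2) (S' := T) (fun X => tpi2 (ix_tan d X)) f A) in pr2.
    replace a2 with (niso_inv (pn_iso T2 f) A) in e3; [exact (eq_sym e3) |].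
    apply (pullback_mono (M X (pf_map F f A))).
    - exact (eq_trans pr1 (eq_sym e1)).
    - exact (eq_trans pr2 (eq_sym e2)). }
  assert (lz : forall (X Y : C) (f : Hom X Y) (A : F Y),
    fmap (pf_map F f) (tzero (ix_tan d Y) A) ∘ pn_iso (pn_id F) f A
    = pn_iso T f A ∘ tzero (ix_tan d X) (pf_map F f A)).
  { intros X Y f A; apply (modification_square (S := pn_id F) (S' := T)
      (fun X => tzero (ix_tan d X)) f A).
    cbn; rewrite comp_id_r; exact (eq_sym (tm_zero (TM X Y f) A)). }
  exists {| oT := T : cell1 (F : Bicat C) F; oT2 := T2;
    opi1 := Build_Modification (S := T2) (T := T) pr1;
    opi2 := Build_Modification (S := T2) (T := T) pr2;
    op := p;
    ozero := Build_Modification (S := pn_id F) (T := T) lz;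
    oadd := Build_Modification (S := T2) (T := T) la;
    olift := Build_Modification (S := T) (T := pn_comp T T) (fun X Y f A =>
      proj2 (modification_square (S := T) (S' := pn_comp T T)
        (fun X => tlift (ix_tan d X)) f A) (tm_lift (TM X Y f) A));
    oflip := Build_Modification (S := pn_comp T T) (T := pn_comp T T) (fun X Y f A =>
      proj2 (modification_square (S := pn_comp T T) (S' := pn_comp T T)
        (fun X => tflip (ix_tan d X)) f A) (tm_flip (TM X Y f) A)) |}.
  (* Inverting the comparison cells twice gives them back by conversion, thanks to eta for primitive
     records. *)
  reflexivity.
Qed.
End Assembly.

(** A tuple in [Bicat C] is a tangent object if and only if its components make
    [F] a tangent indexing functor, and every structure of tangent indexing
    functor on [F] consists of the components of such a tuple. *)
Theorem theorem1p2 (C : Category) (F : Pseudofunctor C) :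
  (forall t : TangentTuple (K := Bicat C) F,
     IsTangentObject t <-> IsTangentIndexing (tuple_data t)) /\
  (forall d : IndexingData F,
     IsTangentIndexing d -> exists t : TangentTuple (K := Bicat C) F, tuple_data t = d).
Proof.
split; [intros t; split |].
- apply tangent_object_indexing.
- apply indexing_tangent_object.
- apply indexing_tuple.
Qed.
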